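(* Consider the theory in the language $\{\times,{}^{-1},\mathbf 0,\mathbf 1,\boldsymbol\omega_2,\boldsymbol\omega_3,\boldsymbol\omega_4,\dots\}$ with the following axioms, where $n$ ranges over all natural numbers $n>1$: (M$_1$) $\forall x,y,z\,(x\cdot(y\cdot z)=(x\cdot y)\cdot z)$; (M$_2$) $\forall x\,(x\cdot\mathbf 1=x)$; (M$_3$) $\forall x\,(x\neq\mathbf 0\rightarrow x\cdot x^{-1}=\mathbf 1)$; (M$_4$) $\forall x,y\,(x\cdot y=y\cdot x)$; (M$_5$) $\forall x\,(x\cdot\mathbf 0=\mathbf 0=\mathbf 0^{-1})$; (M$_{6,n}$) $\bigwedge_{0\le i<j<n}(\boldsymbol\omega_n)^i\neq(\boldsymbol\omega_n)^j$; (M$_{7,n}$) $\forall x\,\bigl(x^n=\mathbf 1\leftrightarrow\bigvee_{0\le i<n}x=(\boldsymbol\omega_n)^i\bigr)$; (M$_{8,n}$) $\forall x\,\exists y\,(y^n=x)$. This theory completely axiomatizes the multiplicative theory of the complex numbers. Moreover, the structure $\langle\mathbb C;\times,{}^{-1},\mathbf 0,\mathbf 1,\boldsymbol\omega_2,\boldsymbol\omega_3,\boldsymbol\omega_4,\dots\rangle$ admits quantifier elimination, and so has a decidable theory.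
   Context: The multiplicative theory of a set of numbers closed under multiplication is the first-order theory of the structure consisting of that set with (solely) the multiplication operation; here it is the theory of $\langle\mathbb C;\times\rangle$. A theory $T$ completely axiomatizes it if, for every first-order sentence in the language $\{\times\}$, the sentence is true in $\langle\mathbb C;\times\rangle$ if and only if it is provable from $T$. The symbols $\times$ and $\cdot$ are used interchangeably. In $\mathbb C$, $\boldsymbol\omega_n$ is interpreted as $\cos(2\pi/n)+\mathrm i\sin(2\pi/n)$ for $n\ge 2$, ${}^{-1}$ is the multiplicative inverse on nonzero elements, and by convention $0^{-1}=0$. $x^n$ abbreviates $x\cdot x\cdots x$ ($n$ times), with $x^0=\mathbf 1$. A structure admits quantifier elimination if every formula of its language is equivalent in the structure to a quantifier-free formula of that language. A theory is decidable if there is an algorithm deciding whether a given sentence belongs to it. *)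

(* Defs.v *)
From HB Require Import structures.
From Stdlib Require List.
From mathcomp Require Import all_boot all_order all_algebra.
From mathcomp Require Import complex.
From mathcomp Require Import boolp reals trigo.

Set Implicit Arguments.
Unset Strict Implicit.
Unset Printing Implicit Defensive.

Import GRing.Theory.

(** * Syntax: the language {*, ^-1, 0, 1, omega_2, omega_3, ...} *)

(* Variables are de Bruijn indices.  [Omega k] is the constant symbol
   omega_(k+2), so that exactly the omega_n with n >= 2 are available. *)
Inductive term : Type :=
| Var of nat
| Mul of term & term
| Inv of term
| Zero
| One
| Omega of nat.

Inductive formula : Type :=
| Eq of term & term
| Bot
| Imp of formula & formula
| All of formula.

Definition Top : formula := Imp Bot Bot.
Definition Not (phi : formula) : formula := Imp phi Bot.
Definition Neq (t u : term) : formula := Not (Eq t u).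
Definition Or (phi psi : formula) : formula := Imp (Not phi) psi.
Definition And (phi psi : formula) : formula := Not (Imp phi (Not psi)).
Definition Iff (phi psi : formula) : formula := And (Imp phi psi) (Imp psi phi).
Definition Ex (phi : formula) : formula := Not (All (Not phi)).
Definition Conj (s : seq formula) : formula := foldr And Top s.
Definition Disj (s : seq formula) : formula := foldr Or Bot s.

(* [tpow t n] is t . (t . (... . t)) with n factors, and [tpow t 0] is 1. *)
Definition tpow (t : term) (n : nat) : term := iterop n Mul t One.

Fixpoint term_below (k : nat) (t : term) : bool :=
  match t with
  | Var i => i < k
  | Mul t u => term_below k t && term_below k u
  | Inv t => term_below k t
  | Zero | One | Omega _ => true
  end.

(* All free variables of the formula have an index smaller than k. *)
Fixpoint formula_below (k : nat) (phi : formula) : bool :=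
  match phi with
  | Eq t u => term_below k t && term_below k u
  | Bot => true
  | Imp phi psi => formula_below k phi && formula_below k psi
  | All phi => formula_below k.+1 phi
  end.

Definition sentence (phi : formula) : bool := formula_below 0 phi.

Fixpoint quantifier_free (phi : formula) : bool :=
  match phi with
  | Eq _ _ | Bot => true
  | Imp phi psi => quantifier_free phi && quantifier_free psi
  | All _ => false
  end.

(* Membership in the sublanguage whose only non-logical symbol is *. *)
Fixpoint mul_term (t : term) : bool :=
  match t with
  | Var _ => true
  | Mul t u => mul_term t && mul_term u
  | Inv _ | Zero | One | Omega _ => false
  end.

Fixpoint mul_formula (phi : formula) : bool :=
  match phi with
  | Eq t u => mul_term t && mul_term u
  | Bot => true
  | Imp phi psi => mul_formula phi && mul_formula psi
  | All phi => mul_formula phi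
  end.

(** * Simultaneous capture-avoiding substitution *)

Fixpoint tsubst (s : nat -> term) (t : term) : term :=
  match t with
  | Var i => s i
  | Mul t u => Mul (tsubst s t) (tsubst s u)
  | Inv t => Inv (tsubst s t)
  | Zero => Zero
  | One => One
  | Omega k => Omega k
  end.

Definition up (s : nat -> term) (i : nat) : term :=
  if i is j.+1 then tsubst (fun k => Var k.+1) (s j) else Var 0.

Fixpoint fsubst (s : nat -> term) (phi : formula) : formula :=
  match phi with
  | Eq t u => Eq (tsubst s t) (tsubst s u)
  | Bot => Bot
  | Imp phi psi => Imp (fsubst s phi) (fsubst s psi)
  | All phi => All (fsubst (up s) phi)
  end.

Definition flift (phi : formula) : formula := fsubst (fun k => Var k.+1) phi.

(* phi[t]: index 0 is replaced by t, and the other indices are decremented. *)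
Definition finst (phi : formula) (t : term) : formula :=
  fsubst (fun i => if i is j.+1 then Var j else t) phi.

(** * Provability: classical natural deduction with equality *)

Inductive derives : seq formula -> formula -> Prop :=
| Ax G phi : List.In phi G -> derives G phi
| ImpI G phi psi : derives (phi :: G) psi -> derives G (Imp phi psi)
| ImpE G phi psi : derives G (Imp phi psi) -> derives G phi -> derives G psi
| Contra G phi : derives (Not phi :: G) Bot -> derives G phi
| AllI G phi : derives (map flift G) phi -> derives G (All phi)
| AllE G phi t : derives G (All phi) -> derives G (finst phi t)
| EqRefl G t : derives G (Eq t t)
| EqSubst G phi t u :
    derives G (Eq t u) -> derives G (finst phi t) -> derives G (finst phi u).

Definition provable (T : formula -> Prop) (phi : formula) : Prop :=
  exists2 G : seq formula, (forall psi, List.In psi G -> T psi) & derives G phi.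

(** * Semantics *)

Record structure := Structure {
  carrier :> Type;
  mul_of : carrier -> carrier -> carrier;
  inv_of : carrier -> carrier;
  zero_of : carrier;
  one_of : carrier;
  omega_of : nat -> carrier (* indexed as [Omega] *)
}.

Fixpoint eval (M : structure) (e : nat -> M) (t : term) : M :=
  match t with
  | Var i => e i
  | Mul t u => mul_of (eval e t) (eval e u)
  | Inv t => inv_of (eval e t)
  | Zero => zero_of M
  | One => one_of M
  | Omega k => omega_of M k
  end.

Definition scons (M : Type) (x : M) (e : nat -> M) (i : nat) : M :=
  if i is j.+1 then e j else x.

Fixpoint sat (M : structure) (e : nat -> M) (phi : formula) : Prop :=
  match phi with
  | Eq t u => eval e t = eval e u
  | Bot => False
  | Imp phi psi => sat e phi -> sat e psi
  | All phi => forall x : M, sat (scons x e) phi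
  end.

Definition models (M : structure) (phi : formula) : Prop :=
  forall e : nat -> M, sat e phi.

(* T may use the whole language, but only the sentences of the language {*}
   have to be decided by T; their truth in M involves only the reduct of M to
   its multiplication. *)
Definition axiomatizes_mul_theory (T : formula -> Prop) (M : structure) : Prop :=
  forall phi : formula, sentence phi -> mul_formula phi ->
    (models M phi <-> provable T phi).

Definition quantifier_elimination (M : structure) : Prop :=
  forall phi : formula, exists2 psi : formula, quantifier_free psi &
    forall e : nat -> M, sat e phi <-> sat e psi.

(** * Decidability *)

(* The total recursive functions: the closure of the initial functions under
   composition, primitive recursion and minimization of regular functions. *)
Inductive recursive : forall k : nat, (k.-tuple nat -> nat) -> Prop :=
| RecZero k : @recursive k (fun=> 0)
| RecSucc : @recursive 1 (fun v => (thead v).+1)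
| RecProj k (i : 'I_k) : @recursive k (fun v => tnth v i)
| RecComp k m (g : m.-tuple nat -> nat) (h : 'I_m -> k.-tuple nat -> nat) :
    recursive g -> (forall i, recursive (h i)) ->
    @recursive k (fun v => g [tuple h i v | i < m])
| RecPrim k (g : k.-tuple nat -> nat) (h : k.+2.-tuple nat -> nat)
    (f : k.+1.-tuple nat -> nat) :
    recursive g -> recursive h ->
    (forall v : k.-tuple nat, f [tuple of 0 :: v] = g v) ->
    (forall n (v : k.-tuple nat),
       f [tuple of n.+1 :: v] = h [tuple of n :: f [tuple of n :: v] :: v]) ->
    recursive f
| RecMin k (g : k.+1.-tuple nat -> nat) (f : k.-tuple nat -> nat) :
    recursive g ->
    (forall v : k.-tuple nat, g [tuple of f v :: v] = 0) ->
    (forall (v : k.-tuple nat) n, n < f v -> g [tuple of n :: v] <> 0) ->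
    recursive f.

(* Goedel numbers *)
Fixpoint tcode (t : term) : nat :=
  match t with
  | Var i => CodeSeq.code [:: 0; i]
  | Mul t u => CodeSeq.code [:: 1; tcode t; tcode u]
  | Inv t => CodeSeq.code [:: 2; tcode t]
  | Zero => CodeSeq.code [:: 3]
  | One => CodeSeq.code [:: 4]
  | Omega k => CodeSeq.code [:: 5; k]
  end.

Fixpoint fcode (phi : formula) : nat :=
  match phi with
  | Eq t u => CodeSeq.code [:: 0; tcode t; tcode u]
  | Bot => CodeSeq.code [:: 1]
  | Imp phi psi => CodeSeq.code [:: 2; fcode phi; fcode psi]
  | All phi => CodeSeq.code [:: 3; fcode phi]
  end.

Definition decidable_theory (M : structure) : Prop :=
  exists2 f : 1.-tuple nat -> nat, recursive f &
    forall phi : formula, sentence phi ->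
      f [tuple fcode phi] = `[< models M phi >].

(** * The axioms *)

(* In [M6], [M7] and [M8], k.+2 ranges over the integers n > 1, and [Omega k]
   is omega_n. *)
Inductive mul_axiom : formula -> Prop :=
| M1 : mul_axiom (All (All (All
    (Eq (Mul (Var 2) (Mul (Var 1) (Var 0)))
        (Mul (Mul (Var 2) (Var 1)) (Var 0))))))
| M2 : mul_axiom (All (Eq (Mul (Var 0) One) (Var 0)))
| M3 : mul_axiom (All
    (Imp (Neq (Var 0) Zero) (Eq (Mul (Var 0) (Inv (Var 0))) One)))
| M4 : mul_axiom (All (All
    (Eq (Mul (Var 1) (Var 0)) (Mul (Var 0) (Var 1)))))
| M5 : mul_axiom (All
    (And (Eq (Mul (Var 0) Zero) Zero) (Eq Zero (Inv Zero))))
| M6 k : mul_axiom (Conj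
    [seq Neq (tpow (Omega k) i) (tpow (Omega k) j)
       | j <- iota 0 k.+2, i <- iota 0 j])
| M7 k : mul_axiom (All
    (Iff (Eq (tpow (Var 0) k.+2) One)
         (Disj [seq Eq (Var 0) (tpow (Omega k) i) | i <- iota 0 k.+2])))
| M8 k : mul_axiom (All (Ex (Eq (tpow (Var 0) k.+2) (Var 1)))).

(** * The structure of the complex numbers *)

Local Open Scope ring_scope.
Local Open Scope complex_scope.

(* omega_n = cos (2 pi / n) + i sin (2 pi / n) *)
Definition croot (R : realType) (n : nat) : R[i] :=
  cos (2 * pi / n%:R) +i* sin (2 * pi / n%:R).

(* The inverse of a MathComp field satisfies 0^-1 = 0. *)
Definition Cmul (R : realType) : structure :=
  @Structure R[i] *%R GRing.inv 0 1 (fun k => croot R k.+2).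

(* Main.v *)
Require Import Defs.
From HB Require Import structures.
From Stdlib Require List.
From mathcomp Require Import all_boot all_order all_algebra.
From mathcomp Require Import zify ring lra.
From mathcomp Require Import complex.
From mathcomp Require Import boolp reals trigo.

Set Implicit Arguments.
Unset Strict Implicit.
Unset Printing Implicit Defensive.

Import Order.TTheory GRing.Theory Num.Theory.

(** The nonzero elements of a model of the axioms form a divisible abelian
    group G in which the n-th roots of unity form a cyclic group of order n.
    Truth of a formula at a tuple a of such a group depends only on which a_i
    are zero and on which relations [a^m = z^j] hold, where z is a root of
    unity of a suitable fixed order b and the exponents m are bounded by a
    number that is computed from the formula.  This is a bounded
    back-and-forth argument: if a and a' satisfy the same such relations up
    to a large bound K, then for every x there is a y such that (a, x) and
    (a', y) satisfy the same relations up to k ([group_forth], [transfer]).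

    The three claims follow from this one transfer principle.

    - Completeness.  All models of the axioms satisfy the same sentences of
      the language with multiplication alone ([mul_elementary]): for the empty
      tuple the relations only speak of the order of z.  What is true in the
      complex numbers is then true in all models, so it is provable by Goedel's
      completeness theorem ([completeness]).  The axioms do not relate the
      constants omega_n for different n, but a single root of unity z of
      a large order is all that a given formula needs.

    - Quantifier elimination.  Over the complex numbers the bounded relations
      are finitely many quantifier-free formulas ([type_atoms]), and a
      predicate that depends only on the truth of finitely many formulas is
      a Boolean combination of them ([qf_definable]).

    - Decidability.  The group that answers the moves of the back-and-forth
      need not contain elements of infinite order: as long as exponents are
      bounded, a root of unity of very large order behaves like such an
      element.  So the quantifiers of a sentence may be restricted to zero and
      to roots of unity whose orders divide powers of b that grow with the
      depth of the quantifier, and the truth of the sentence becomes a finite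
      computation with exponents modulo a power of b ([models_formula_value]).
      That computation is a course-of-values recursion
      ([formula_value_codeP]), so it is recursive. *)

(** * Substitution and semantics *)

Lemma tsubst_tsubst s r t : tsubst s (tsubst r t) = tsubst (tsubst s \o r) t.
Proof. by elim: t => //= [t -> u -> | t ->]. Qed.

Lemma up_comp s r : tsubst (up s) \o up r = up (tsubst s \o r).
Proof. by apply: funext => -[|j] //=; rewrite !tsubst_tsubst. Qed.

Lemma fsubst_fsubst s r phi :
  fsubst s (fsubst r phi) = fsubst (tsubst s \o r) phi.
Proof.
elim: phi s r => //= [t u | phi IH psi IH' | phi IH] s r.
- by rewrite !tsubst_tsubst.
- by rewrite IH IH'.
- by rewrite IH up_comp.
Qed.

Lemma eq_tsubst_below k s r t :
  term_below k t -> (forall i, i < k -> s i = r i) -> tsubst s t = tsubst r t.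
Proof.
move=> tk sr; elim: t tk => //= [t IH u IH' /andP[/IH-> /IH'->] | t IH /IH->] //.
Qed.

Lemma eq_fsubst_below k s r phi :
  formula_below k phi -> (forall i, i < k -> s i = r i) ->
  fsubst s phi = fsubst r phi.
Proof.
elim: phi k s r => //= [t u | phi IH psi IH' | phi IH] k s r.
- by move=> /andP[tk uk] sr; rewrite !(eq_tsubst_below _ sr).
- by move=> /andP[tk uk] sr; rewrite (IH k s r) ?(IH' k s r).
- by move=> phik sr; rewrite (IH k.+1 (up s) (up r)) // => -[|i] //= /sr->.
Qed.

Lemma up_Var : up Var = Var. Proof. by apply: funext => -[]. Qed.

Lemma tsubst_Var t : tsubst Var t = t.
Proof. by elim: t => //= [t -> u -> | t ->]. Qed.

Lemma fsubst_Var phi : fsubst Var phi = phi.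
Proof.
elim: phi => //= [t u | phi -> psi -> | phi IH] //; first by rewrite !tsubst_Var.
by rewrite up_Var IH.
Qed.

Lemma fsubst_sentence s phi : sentence phi -> fsubst s phi = phi.
Proof. by move=> ph; rewrite (@eq_fsubst_below 0 s Var) // fsubst_Var. Qed.

Lemma term_below_mono k l t : k <= l -> term_below k t -> term_below l t.
Proof.
move=> kl; elim: t => //= [i ik | t IH u IH' /andP[/IH-> /IH'->]] //.
exact: leq_trans kl.
Qed.

Lemma formula_below_mono k l phi :
  k <= l -> formula_below k phi -> formula_below l phi.
Proof.
elim: phi k l => //= [t u | phi IH psi IH' | phi IH] k l kl.
- by move=> /andP[tk uk]; rewrite !(term_below_mono kl).
- by move=> /andP[tk uk]; rewrite (IH k l) ?(IH' k l).
- by apply: IH.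
Qed.

Lemma tsubst_below k l s t : term_below k t ->
  (forall i, i < k -> term_below l (s i)) -> term_below l (tsubst s t).
Proof.
move=> tk sl; elim: t tk => //= [t IH u IH' /andP[/IH-> /IH'->]] //.
Qed.

Lemma fsubst_below k l s phi : formula_below k phi ->
  (forall i, i < k -> term_below l (s i)) -> formula_below l (fsubst s phi).
Proof.
elim: phi k l s => //= [t u | phi IH psi IH' | phi IH] k l s.
- by move=> /andP[tk uk] sl; rewrite !(tsubst_below (k := k)).
- by move=> /andP[tk uk] sl; rewrite (IH k) ?(IH' k).
- move=> phik sl; apply: (IH k.+1) => // -[|i] //= /sl sil.
  by apply: (tsubst_below sil).
Qed.

Fixpoint term_bound (t : term) : nat :=
  match t with
  | Var i => i.+1
  | Mul t u => maxn (term_bound t) (term_bound u)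
  | Inv t => term_bound t
  | Zero | One | Omega _ => 0
  end.

Fixpoint formula_bound (phi : formula) : nat :=
  match phi with
  | Eq t u => maxn (term_bound t) (term_bound u)
  | Bot => 0
  | Imp phi psi => maxn (formula_bound phi) (formula_bound psi)
  | All phi => formula_bound phi
  end.

Lemma term_below_bound t : term_below (term_bound t) t.
Proof.
elim: t => //= t IH u IH'.
by rewrite (term_below_mono _ IH) ?(term_below_mono _ IH') ?leq_maxl ?leq_maxr.
Qed.

Lemma formula_below_bound phi : formula_below (formula_bound phi) phi.
Proof.
elim: phi => //= [t u | phi IH psi IH' | phi IH].
- rewrite (term_below_mono _ (term_below_bound t)) ?leq_maxl //=.
  by rewrite (term_below_mono _ (term_below_bound u)) ?leq_maxr.
- rewrite (formula_below_mono _ IH) ?leq_maxl //=.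
  by rewrite (formula_below_mono _ IH') ?leq_maxr.
- exact: formula_below_mono IH.
Qed.

Lemma eval_tsubst (M : structure) (e : nat -> M) s t :
  eval e (tsubst s t) = eval (fun i => eval e (s i)) t.
Proof. by elim: t => //= [t -> u -> | t ->]. Qed.

Lemma sat_fsubst (M : structure) (e : nat -> M) s phi :
  sat e (fsubst s phi) <-> sat (fun i => eval e (s i)) phi.
Proof.
elim: phi e s => //= [t u | phi IH psi IH' | phi IH] e s.
- by rewrite !eval_tsubst.
- by rewrite IH IH'.
- have upE x : (fun i => eval (scons x e) (up s i)) =
               scons x (fun i => eval e (s i)).
    by apply: funext => -[|i] //=; rewrite eval_tsubst.
  by split=> + x => /(_ x); rewrite IH upE.
Qed.

Lemma eq_eval_below (M : structure) k (e f : nat -> M) t :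
  term_below k t -> (forall i, i < k -> e i = f i) -> eval e t = eval f t.
Proof.
move=> tk ef; elim: t tk => //= [t IH u IH' /andP[/IH-> /IH'->] | t IH /IH->] //.
Qed.

Lemma eq_sat_below (M : structure) k (e f : nat -> M) phi :
  formula_below k phi -> (forall i, i < k -> e i = f i) -> sat e phi <-> sat f phi.
Proof.
elim: phi k e f => //= [t u | phi IH psi IH' | phi IH] k e f.
- by move=> /andP[tk uk] ef; rewrite !(eq_eval_below _ ef).
- by move=> /andP[tk uk] ef; rewrite (IH k e f) ?(IH' k e f).
- move=> phik ef; have H x : sat (scons x e) phi <-> sat (scons x f) phi.
    by apply: (IH k.+1) => // -[|i] //=; apply: ef.
  by split=> + x => /(_ x) /H.
Qed.

Lemma sat_flift (M : structure) (e : nat -> M) x phi :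
  sat (scons x e) (flift phi) <-> sat e phi.
Proof. exact: sat_fsubst. Qed.

Lemma sat_finst (M : structure) (e : nat -> M) phi t :
  sat e (finst phi t) <-> sat (scons (eval e t) e) phi.
Proof.
rewrite sat_fsubst.
suff -> : (fun i => eval e (if i is j.+1 then Var j else t)) = scons (eval e t) e by [].
by apply: funext => -[].
Qed.

Lemma soundness (M : structure) G phi : derives G phi ->
  forall e : nat -> M, (forall psi, List.In psi G -> sat e psi) -> sat e phi.
Proof.
elim=> {G phi} /=.
- by move=> G phi Gphi e; apply.
- by move=> G phi psi _ IH e Ge phie; apply: IH => chi [<-|/Ge].
- by move=> G phi psi _ IH _ IH' e Ge; apply: IH => //; apply: IH'.
- move=> G phi _ IH e Ge; apply: contrapT => nphi.
  by apply: (IH e) => chi [<-|/Ge].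
- move=> G phi _ IH e Ge x; apply: IH => chi /List.in_map_iff[psi [<-]] /Ge.
  by rewrite sat_flift.
- by move=> G phi t _ IH e Ge; rewrite sat_finst; apply: IH.
- by [].
- move=> G phi t u _ IH _ IH' e Ge; rewrite sat_finst -(IH e Ge) -sat_finst.
  exact: IH'.
Qed.

Lemma soundness_theory (T : formula -> Prop) (M : structure) phi :
  (forall psi, T psi -> models M psi) -> provable T phi -> models M phi.
Proof. by move=> TM [G GT /soundness H] e; apply: H => psi /GT/TM. Qed.

(** * Goedel completeness of the proof system *)

Lemma weaken G G' phi : derives G phi ->
  (forall psi, List.In psi G -> List.In psi G') -> derives G' phi.
Proof.
move=> d; elim: d G' => {G phi}.
- by move=> G phi Gphi G' GG'; apply/Ax/GG'.
- move=> G phi psi _ IH G' GG'; apply/ImpI/IH => chi /= [->|/GG']; by auto.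
- by move=> G phi psi _ IH _ IH' G' GG'; apply: ImpE (IH _ GG') (IH' _ GG').
- move=> G phi _ IH G' GG'; apply/Contra/IH => chi /= [->|/GG']; by auto.
- move=> G phi _ IH G' GG'; apply/AllI/IH => chi /List.in_map_iff[psi [<-]] /GG' ?.
  exact: List.in_map.
- by move=> G phi t _ IH G' GG'; apply/AllE/IH.
- by move=> G t G' _; apply: EqRefl.
- by move=> G phi t u _ IH _ IH' G' GG'; apply: EqSubst (IH _ GG') (IH' _ GG').
Qed.

Lemma fsubst_flift s phi : fsubst (up s) (flift phi) = flift (fsubst s phi).
Proof. by rewrite /flift !fsubst_fsubst. Qed.

Lemma fsubst_finst s phi t :
  fsubst s (finst phi t) = finst (fsubst (up s) phi) (tsubst s t).
Proof.
rewrite /finst !fsubst_fsubst; congr fsubst; apply: funext => -[|j] //=.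
by rewrite tsubst_tsubst tsubst_Var.
Qed.

Lemma derives_subst G phi s :
  derives G phi -> derives (map (fsubst s) G) (fsubst s phi).
Proof.
move=> d; elim: d s => {G phi}.
- by move=> G phi Gphi s; apply/Ax/List.in_map.
- by move=> G phi psi _ IH s; apply/ImpI/IH.
- by move=> G phi psi _ IH _ IH' s; apply: ImpE (IH s) (IH' s).
- by move=> G phi _ IH s; apply/Contra/IH.
- move=> G phi _ IH s; apply: AllI => /=; move: (IH (up s)).
  by rewrite -!map_comp; under [X in derives X]eq_map do rewrite /= fsubst_flift.
- by move=> G phi t _ IH s; rewrite fsubst_finst; apply/AllE/IH.
- by move=> G t s; apply: EqRefl.
- move=> G phi t u _ IH _ IH' s; rewrite fsubst_finst; apply: EqSubst (IH s) _.
  by rewrite -fsubst_finst.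
Qed.

(** Generalization over a variable x that is used as a constant: the
    substitution that sends x to the bound index 0 and shifts all others turns
    a derivation about x into the premise of the rule of generalization. *)
Lemma AllI_fresh G phi x :
  (forall psi, List.In psi G -> formula_below x psi) -> formula_below x.+1 phi ->
  derives G (finst phi (Var x)) -> derives G (All phi).
Proof.
move=> Gx phix; pose s y := if y == x then Var 0 else Var y.+1.
move=> /(derives_subst s) d; apply: AllI.
have -> : map flift G = map (fsubst s) G.
  apply: List.map_ext_in => psi /Gx psix.
  apply: (eq_fsubst_below psix) => i ix.
  by rewrite /s ltn_eqF.
move: d; rewrite /finst fsubst_fsubst (@eq_fsubst_below x.+1 _ Var) ?fsubst_Var //.
by case=> [|i] /= ix; rewrite /s ?eqxx // ltn_eqF.
Qed.

Definition adjoin (S : formula -> Prop) (phi psi : formula) : Prop :=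
  S psi \/ psi = phi.

Definition consistent (S : formula -> Prop) : Prop := ~ provable S Bot.

Lemma provable_mono (S S' : formula -> Prop) phi :
  (forall psi, S psi -> S' psi) -> provable S phi -> provable S' phi.
Proof. by move=> SS' [G GS d]; exists G => // psi /GS/SS'. Qed.

Lemma provable_ax (S : formula -> Prop) phi : S phi -> provable S phi.
Proof.
by move=> Sphi; exists [:: phi]; [move=> psi /= [<-|] | apply: Ax; left].
Qed.

Lemma provable_impE (S : formula -> Prop) phi psi :
  provable S (Imp phi psi) -> provable S phi -> provable S psi.
Proof.
move=> [G GS d] [G' G'S d']; exists (G ++ G').
  by move=> chi /List.in_app_iff[/GS|/G'S].
by apply: (ImpE (weaken d _) (weaken d' _)) => chi ?; apply/List.in_app_iff; auto.
Qed.

Lemma provable_impI (S : formula -> Prop) phi psi :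
  provable (adjoin S phi) psi -> provable S (Imp phi psi).
Proof.
move=> [G GS d].
have [G' G'S GG'] : exists2 G', (forall chi, List.In chi G' -> S chi) &
    (forall chi, List.In chi G -> List.In chi (phi :: G')).
  elim: G GS {d} => [|chi G IH] GS; first by exists [::].
  have [|G' G'S GG'] := IH; first by move=> c Gc; apply: GS; right.
  have [Schi | ->] := GS chi (or_introl erefl).
    exists (chi :: G') => [c /= [<-|/G'S]|c /= [<-|/GG' /= []]] //; by auto.
  by exists G' => // c /= [<-|/GG' /= []]; auto.
by exists G' => //; apply/ImpI/(weaken d).
Qed.

Lemma provable_logic (S : formula -> Prop) phi :
  derives [::] phi -> provable S phi.
Proof. by exists [::]. Qed.

Lemma provable_map (S : formula -> Prop) phi psi :
  derives [:: phi] psi -> provable S phi -> provable S psi.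
Proof. by move=> d; apply/provable_impE/provable_logic/ImpI. Qed.

Lemma provable_contra (S : formula -> Prop) phi :
  provable S (Not (Not phi)) -> provable S phi.
Proof.
by apply: provable_map; apply: Contra; apply: (@ImpE _ (Not phi)); apply: Ax => /=; auto.
Qed.

Lemma provable_exfalso (S : formula -> Prop) phi :
  provable S Bot -> provable S phi.
Proof. by apply: provable_map; apply: Contra; apply: Ax => /=; auto. Qed.

Lemma code_inj : injective CodeSeq.code.
Proof. exact: can_inj CodeSeq.codeK. Qed.

Lemma tcode_inj : injective tcode.
Proof.
elim=> [i|t IH u IH'|t IH|||k] [j|t' u'|t'|||l] /code_inj //= [] //.
- by move->.
- by move=> /IH-> /IH'->.
- by move=> /IH->.
- by move->.
Qed.

Lemma fcode_inj : injective fcode.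
Proof.
elim=> [t u||phi IH psi IH'|phi IH] [t' u'||phi' psi'|phi'] /code_inj //= [] //.
- by move=> /tcode_inj-> /tcode_inj->.
- by move=> /IH-> /IH'->.
- by move=> /IH->.
Qed.

Definition choose_or (T : Type) (x0 : T) (P : T -> Prop) : T :=
  if pselect (exists x, P x) is left h then projT1 (cid h) else x0.

Lemma choose_orP (T : Type) (x0 : T) (P : T -> Prop) x : P x -> P (choose_or x0 P).
Proof.
rewrite /choose_or => Px; case: pselect => [h|[]]; last by exists x.
by case: cid.
Qed.

Section Henkin.
Variable S : formula -> Prop.
Hypothesis S_sentence : forall phi, S phi -> sentence phi.
Hypothesis S_consistent : consistent S.

Definition enum_formula (n : nat) : formula :=
  choose_or Bot (fun phi => fcode phi = n).

Lemma enum_formulaK phi : enum_formula (fcode phi) = phi.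
Proof.
apply: fcode_inj.
exact: (choose_orP (P := fun psi => fcode psi = fcode phi) Bot (erefl (fcode phi))).
Qed.

(** The n-th Henkin constant is a variable beyond all variables of the formulas
    enumerated so far and beyond the earlier Henkin constants.  As the theory
    consists of sentences, such a variable is fresh. *)
Definition witness (n : nat) : nat :=
  \sum_(i < n.+1) (formula_bound (enum_formula i)).+1.

Definition henkin (n : nat) : formula :=
  Imp (finst (enum_formula n) (Var (witness n))) (All (enum_formula n)).

Definition henkin_set (n : nat) (phi : formula) : Prop :=
  S phi \/ exists2 i, i < n & phi = henkin i.

Lemma bound_witness n : formula_bound (enum_formula n) <= witness n.
Proof. by rewrite /witness big_ord_recr /= addnS -addSn leq_addl. Qed.

Lemma witness_ltn i n : i < n -> witness i < witness n.
Proof.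
elim: n => // n IH; rewrite ltnS leq_eqVlt.
have H : witness n < witness n.+1 by rewrite [witness n.+1]big_ord_recr /= addnS ltnS leq_addr.
by move=> /orP[/eqP->|/IH/ltn_trans->].
Qed.

Lemma henkin_set_below n phi : henkin_set n phi -> formula_below (witness n) phi.
Proof.
case=> [/S_sentence/formula_below_mono->//|[i i_n ->]].
apply: (formula_below_mono (witness_ltn i_n)).
have b := formula_below_mono (leqW (leqW (bound_witness i)))
  (formula_below_bound (enum_formula i)).
rewrite /= b andbT; apply: (fsubst_below b) => -[|j] /=; by rewrite ?ltnS.
Qed.

(** If the n-th Henkin axiom were refutable from the earlier ones, then so
    would be its conclusion, while its premise would be provable about a fresh
    variable, and hence the conclusion as well. *)
Lemma henkin_set_consistent n : consistent (henkin_set n).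
Proof.
elim: n => [|n IH] inc.
  by apply: S_consistent; apply: provable_mono inc => psi [? | []].
have {}inc : provable (henkin_set n) (Not (henkin n)).
  apply: provable_impI; apply: provable_mono inc => psi [?|[j]]; first by left; left.
  rewrite ltnS leq_eqVlt => /orP[/eqP-> -> | jn ->]; first by right.
  by left; right; exists j.
apply/IH/(provable_impE inc).
apply: (provable_map (phi := All (enum_formula n))).
  by apply: ImpI; apply: Ax => /=; auto.
have [G GS d] : provable (henkin_set n) (finst (enum_formula n) (Var (witness n))).
  apply: provable_map inc; apply: Contra.
  apply: (@ImpE _ (henkin n)); first by apply: Ax => /=; auto.
  apply: ImpI; apply: Contra.
  by apply: (@ImpE _ (finst (enum_formula n) (Var (witness n)))); apply: Ax => /=; auto.
exists G => //; apply: (AllI_fresh _ _ d) => [psi /GS/henkin_set_below//|].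
exact: formula_below_mono (leqW (bound_witness n)) (formula_below_bound _).
Qed.

Fixpoint lindenbaum (n : nat) (phi : formula) : Prop :=
  if n is m.+1 then
    lindenbaum m phi \/
    (phi = enum_formula m /\ consistent (adjoin (lindenbaum m) (enum_formula m)))
  else S phi \/ exists i, phi = henkin i.

Definition completion (phi : formula) : Prop := exists n, lindenbaum n phi.

Lemma lindenbaum_mono m n phi : m <= n -> lindenbaum m phi -> lindenbaum n phi.
Proof.
by move=> /subnKC<-; elim: (n - m) => [|k IH] h; rewrite ?addn0 // addnS; left; auto.
Qed.

(** A derivation of a contradiction uses finitely many hypotheses, hence it
    lives in one member of the chain. *)
Lemma consistent_union (F : nat -> formula -> Prop) :
  (forall m n phi, m <= n -> F m phi -> F n phi) ->
  (forall n, consistent (F n)) -> consistent (fun phi => exists n, F n phi).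
Proof.
move=> Fmono Fcons [G GF d].
have [n nG] : exists n, forall psi, List.In psi G -> F n psi.
  elim: G GF {d} => [|psi G IH] GF; first by exists 0.
  have [|n nG] := IH; first by move=> c cG; apply: GF; right.
  have [m mpsi] := GF psi (or_introl erefl).
  exists (maxn m n) => c /= [<-|/nG]; last exact/Fmono/leq_maxr.
  exact/(Fmono m)/mpsi/leq_maxl.
by apply: (Fcons n); exists G.
Qed.

Lemma lindenbaum_consistent n : consistent (lindenbaum n).
Proof.
elim: n => [|n IH] /=.
  have : consistent (fun phi => exists n, henkin_set n phi).
    apply: consistent_union henkin_set_consistent => m n phi mn [?|[i im ->]]; first by left.
    by right; exists i => //; apply: leq_trans mn.
  apply: contra_not; apply: provable_mono => psi [?|[i ->]]; first by exists 0; left.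
  by exists i.+1; right; exists i.
have [c|nc] := pselect (consistent (adjoin (lindenbaum n) (enum_formula n))).
  by apply: contra_not c; apply: provable_mono => psi [?|[-> _]]; [left|right].
by apply: contra_not IH; apply: provable_mono => psi [? | []].
Qed.

Lemma completion_consistent : consistent completion.
Proof. exact: consistent_union lindenbaum_mono lindenbaum_consistent. Qed.

Lemma completion_ext phi : S phi -> completion phi.
Proof. by move=> Sphi; exists 0; left. Qed.

Lemma completion_max phi : ~ completion phi -> provable completion (Not phi).
Proof.
move=> nphi; apply: provable_impI; apply: contrapT => c; apply: nphi.
exists (fcode phi).+1; right; rewrite enum_formulaK; split=> //.
apply: contra_not c; apply: provable_mono => psi [?|->]; last by right.
by left; exists (fcode phi).
Qed.

Lemma completionP phi : completion phi <-> provable completion phi.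
Proof.
split=> [|pphi]; first exact: provable_ax.
apply: contrapT => /completion_max n.
exact: completion_consistent (provable_impE n pphi).
Qed.

Lemma completion_Imp phi psi :
  completion (Imp phi psi) <-> (completion phi -> completion psi).
Proof.
split=> [/completionP h /completionP h'|h].
  by apply/completionP; apply: provable_impE h h'.
apply/completionP; apply: provable_impI.
have [/h c|/completion_max n] := pselect (completion phi).
  by apply: provable_mono (provable_ax c) => ?; left.
apply/provable_exfalso/provable_impE/(provable_ax (or_intror erefl)).
by apply: provable_mono n => ?; left.
Qed.

Lemma completion_All phi :
  completion (All phi) <-> forall t, completion (finst phi t).
Proof.
split=> [/completionP h t|h].
  apply/completionP; apply: provable_map h.
  by apply: AllE; apply: Ax => /=; auto.
have : completion (henkin (fcode phi)) by exists 0; right; exists (fcode phi).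
by rewrite /henkin enum_formulaK => /completion_Imp; apply.
Qed.

Lemma completion_refl t : completion (Eq t t).
Proof. by apply/completionP/provable_logic/EqRefl. Qed.

Lemma completion_subst phi t u :
  completion (Eq t u) -> completion (finst phi t) -> completion (finst phi u).
Proof.
move=> /completionP h /completionP h'; apply/completionP.
apply: (provable_impE _ h'); apply: (provable_impE _ h); apply: provable_logic.
by do 2!apply: ImpI; apply: (@EqSubst _ _ t); apply: Ax => /=; auto.
Qed.

Lemma tsubst_inst_shift t u : tsubst (fun i => if i is j.+1 then Var j else u)
   (tsubst (fun k => Var k.+1) t) = t.
Proof. by rewrite tsubst_tsubst -[RHS]tsubst_Var. Qed.

(** The rule of equality replaces terms in formulas; applied to the formula
    [c(t) = c(X)] it gives congruence for the term context c, whose hole is the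
    variable 0. *)
Lemma completion_cong (c : term) t u :
  completion (Eq t u) ->
  completion (Eq (tsubst (fun i => if i is j.+1 then Var j else t) c)
                 (tsubst (fun i => if i is j.+1 then Var j else u) c)).
Proof.
move=> tu.
set ct := tsubst _ c.
have := @completion_subst (Eq (tsubst (fun k => Var k.+1) ct) c) t u tu.
by rewrite /finst /= !tsubst_inst_shift -/ct; apply; apply: completion_refl.
Qed.

Lemma completion_sym t u : completion (Eq t u) -> completion (Eq u t).
Proof.
move=> tu; have := @completion_subst (Eq (Var 0) (tsubst (fun k => Var k.+1) t)) t u tu.
by rewrite /finst /= !tsubst_inst_shift; apply; apply: completion_refl.
Qed.

Lemma completion_trans t u v :
  completion (Eq t u) -> completion (Eq u v) -> completion (Eq t v).
Proof.
move=> tu uv; have := @completion_subst (Eq (tsubst (fun k => Var k.+1) t) (Var 0)) u v uv.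
by rewrite /finst /= !tsubst_inst_shift; apply.
Qed.

(** Equality in a structure is equality of its carrier, so the term model has
    to be a quotient.  It is realized by representatives: the choice depends
    only on the class of t as a predicate, and equal terms get the same one. *)
Definition rep (t : term) : term := choose_or Zero (fun u => completion (Eq t u)).

Lemma repP t : completion (Eq t (rep t)).
Proof.
exact: (choose_orP (P := fun u => completion (Eq t u)) Zero (completion_refl t)).
Qed.

Lemma rep_eq t u : rep t = rep u <-> completion (Eq t u).
Proof.
split=> [tu|tu].
  by apply: completion_trans (repP t) _; rewrite tu; apply/completion_sym/repP.
congr choose_or; apply: funext => v; apply: propext.
by split; apply: completion_trans => //; apply: completion_sym.
Qed.

Definition term_model_carrier : Type := {t : term | rep t = t}.

Lemma rep_idem t : rep (rep t) = rep t.
Proof. exact/rep_eq/completion_sym/repP. Qed.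

Definition term_class (t : term) : term_model_carrier := exist _ (rep t) (rep_idem t).

Definition term_model : structure :=
  @Structure term_model_carrier
    (fun x y => term_class (Mul (sval x) (sval y)))
    (fun x => term_class (Inv (sval x)))
    (term_class Zero) (term_class One) (fun k => term_class (Omega k)).

Lemma term_class_eq t u : term_class t = term_class u <-> completion (Eq t u).
Proof.
rewrite -rep_eq; split=> [[]//|tu]; apply: eq_exist => /=; exact: tu.
Qed.

Lemma term_class_sval x : term_class (sval x) = x.
Proof. by case: x => t tP; apply: eq_exist. Qed.

Lemma term_class_rep t : completion (Eq (sval (term_class t)) t).
Proof. exact/completion_sym/repP. Qed.

Lemma eval_term_model (e : nat -> term_model) t :
  eval e t = term_class (tsubst (sval \o e) t).
Proof.
elim: t => //= [i | t -> u -> | t ->]; first by rewrite term_class_sval.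
- pose shift := tsubst (fun k => Var k.+1).
  set t' := tsubst _ t; set u' := tsubst _ u; apply/term_class_eq.
  apply: (@completion_trans _ (Mul t' (sval (term_class u')))).
    have := completion_cong (Mul (Var 0) (shift (sval (term_class u')))) (term_class_rep t').
    by rewrite /= !tsubst_inst_shift.
  have := completion_cong (Mul (shift t') (Var 0)) (term_class_rep u').
  by rewrite /= !tsubst_inst_shift.
- apply/term_class_eq.
  by have := completion_cong (Inv (Var 0)) (term_class_rep (tsubst (sval \o e) t)).
Qed.

Lemma sat_term_model (e : nat -> term_model) phi :
  sat e phi <-> completion (fsubst (sval \o e) phi).
Proof.
elim: phi e => /= [t u | | phi IH psi IH' | phi IH] e.
- by rewrite !eval_term_model term_class_eq.
- split=> // c; exact/completion_consistent/provable_ax/c.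
- by rewrite completion_Imp IH IH'.
have E x : fsubst (sval \o scons x e) phi = finst (fsubst (up (sval \o e)) phi) (sval x).
  rewrite /finst fsubst_fsubst; congr fsubst; apply: funext => -[|j] //=.
  by rewrite tsubst_inst_shift.
rewrite completion_All; split=> h t; last by rewrite IH E; apply: h.
have := h (term_class t); rewrite IH E; apply: completion_subst; exact: term_class_rep.
Qed.

End Henkin.

(** Free variables of the language serve as Henkin constants, which is why
    the theory and the formula are required to be closed. *)
Theorem completeness (T : formula -> Prop) phi :
  (forall psi, T psi -> sentence psi) -> sentence phi ->
  (forall M, (forall psi, T psi -> models M psi) -> models M phi) ->
  provable T phi.
Proof.
move=> Tsent phisent H; apply: contrapT => nphi.
pose S := adjoin T (Not phi).
have Ssent psi : S psi -> sentence psi.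
  by case=> [/Tsent//|->]; rewrite /sentence /= andbT.
have Scons : consistent S by move=> /provable_impI/provable_contra.
have truth e psi : sentence psi ->
    sat (M := term_model Ssent Scons) e psi <-> completion S psi.
  by move=> psisent; rewrite sat_term_model fsubst_sentence.
have /(truth (fun=> term_class Ssent Scons Zero) (Not phi)) : completion S (Not phi).
  by apply: completion_ext; right.
apply; first by rewrite /sentence /= andbT.
by apply: H => psi Tpsi e; apply/truth; [apply: Tsent | apply: completion_ext; left].
Qed.

(** * Back-and-forth in divisible abelian groups *)

Local Open Scope ring_scope.

Definition lin (G : zmodType) (n : nat) (m : nat -> int) (a : nat -> G) : G :=
  \sum_(i < n) a i *~ m i.

Definition bounded (n k : nat) (m : nat -> int) : Prop :=
  forall i, (i < n)%N -> (`|m i| <= k)%N.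

Section Lin.
Variables (G : zmodType) (n : nat).
Implicit Types (m : nat -> int) (a : nat -> G).

Lemma linD m m' a : lin n (fun i => m i + m' i) a = lin n m a + lin n m' a.
Proof. by rewrite /lin -big_split; apply: eq_bigr => i _; rewrite mulrzDr. Qed.

Lemma linM c m a : lin n (fun i => c * m i) a = lin n m a *~ c.
Proof. by rewrite /lin mulrz_suml; apply: eq_bigr => i _; rewrite mulrC mulrzA. Qed.

Lemma lin_scons m x a :
  lin n.+1 m (scons x a) = x *~ m 0%N + lin n (fun i => m i.+1) a.
Proof. by rewrite /lin big_ord_recl. Qed.

End Lin.

Lemma leq_step k : (k < (k + 2) ^ (k + 3))%N.
Proof.
apply: (leq_trans (ltn_expl k (isT : 1 < 2)%N)).
apply: (leq_trans (n := 2 ^ (k + 3))%N); first by rewrite leq_exp2l //; lia.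
by rewrite leq_exp2r; lia.
Qed.

(** The elements [z *~ j] are the roots of unity that may occur on the right
    of a relation; only the exponents on the left are bounded. *)
Definition agree (G H : zmodType) (zG : G) (zH : H) (n k : nat)
    (a : nat -> G) (b : nat -> H) : Prop :=
  forall m j, bounded n k m -> lin n m a = zG *~ j <-> lin n m b = zH *~ j.

Section Forth.
Variables (G H : zmodType) (zG : G) (zH : H) (n k : nat).
Variables (a : nat -> G) (b : nat -> H) (x : G).

Definition dependent (l s : nat) : Prop :=
  exists m j, bounded n l m /\ lin n m a + x *+ s = zG *~ j.

(** Passing to the smaller s whenever one occurs at the next level must stop
    after fewer than s steps.  This yields a relation whose exponent of x is
    minimal even among the relations with much larger exponents on a. *)
Lemma dependent_stable l s : (0 < s)%N -> dependent l s ->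
  exists l' s', [/\ (l <= l' <= l * (k + 2) ^ s)%N, (0 < s' <= s)%N, dependent l' s' &
    forall r, (0 < r < s')%N -> ~ dependent ((k + 2) * l') r].
Proof.
elim/ltn_ind: s l => s IH l s0 ls.
have [[r [rs dr]]|nr] := pselect (exists r, (0 < r < s)%N /\ dependent ((k + 2) * l) r).
  have /andP[r0 rs'] := rs.
  have [l' [s' [/andP[l1 l2] s1 d mn]]] := IH r rs' _ r0 dr.
  exists l', s'; split=> //; last by lia.
  apply/andP; split; first by nia.
  apply: (leq_trans l2); rewrite -mulnA mulnCA leq_mul2l -expnS leq_exp2l ?rs' ?orbT //.
  by lia.
exists l, s; split=> //.
- by rewrite leqnn leq_pmulr // expn_gt0; lia.
- by rewrite s0 leqnn.
- by move=> r rs dr; apply: nr; exists r.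
Qed.

(** If no relation of level k involves x, any y that satisfies none will do.
    Otherwise take a relation [x^s = c(a)] with s minimal in the sense of
    [dependent_stable] and any y with [y^s = c(b)].  Euclidean division of an
    exponent of x by s turns a relation of (a, x) into one with an exponent
    r < s.  If r = 0, it speaks of a alone and transfers to b.  If r > 0, it
    fails for x by minimality; and if it held for y, its s-th power would
    transfer back to a, so that it would hold for x up to an s-th root of
    unity, which is again one of the allowed right hand sides. *)
Lemma group_forth (D : nat) (Q : H -> Prop) :
  (forall u : G, u *+ D = 0 -> exists j : int, u = zG *~ j) ->
  (forall s, (0 < s <= k)%N -> (s %| D)%N) ->
  agree zG zH n ((k + 2) ^ (k + 3)) a b ->
  (forall m (j : int) s, (0 < s <= k)%N ->
     exists2 y, Q y & y *+ s = zH *~ j - lin n m b) ->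
  (exists2 y, Q y & forall s m (j : int), (0 < s <= k)%N -> bounded n k m ->
     lin n m b + y *+ s <> zH *~ j) ->
  exists2 y, Q y & agree zG zH n.+1 k (scons x a) (scons y b).
Proof.
move=> torG kD ab Qdiv Qind.
have K0 : (k <= (k + 2) ^ (k + 3))%N by apply/ltnW/leq_step.
have [[s [sk dep]]|indep] :=
    pselect (exists s, (0 < s <= k)%N /\ dependent (k + 2) s); last first.
  have [y Qy yind] := Qind; exists y => // m j mk.
  rewrite !lin_scons.
  have mk' : bounded n k (fun i => m i.+1) by move=> i ni; apply: mk.
  have m0k := mk 0%N isT.
  case: (m 0%N) m0k => [[|s]|s] /= sk.
  - by rewrite !mulr0z !add0r; apply: ab => i ni; apply: leq_trans K0; apply: mk'.
  - split=> E; exfalso.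
      apply: indep; exists s.+1; split; first by rewrite sk.
      exists (fun i => m i.+1), j; split; last by rewrite addrC.
      by move=> i ni; apply: leq_trans (mk' i ni) _; lia.
    by apply: (yind s.+1 (fun i => m i.+1) j) => //; rewrite addrC.
  - have neg (V : zmodType) (u v w : V) : u *- s.+1 + v = w -> v *~ (-1) + u *+ s.+1 = - w.
      by move=> <-; rewrite mulrN1z opprD opprK addrC.
    have mN : bounded n k (fun i => -1 * m i.+1).
      by move=> i ni; rewrite mulN1r abszN; apply: mk'.
    split=> /neg E; exfalso.
      apply: indep; exists s.+1; split; first by rewrite sk.
      exists (fun i => -1 * m i.+1), (- j); split; last by rewrite linM E mulrNz.
      by move=> i ni; apply: leq_trans (mN i ni) _; lia.
    apply: (yind s.+1 (fun i => -1 * m i.+1) (- j)) => //.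
    by rewrite linM E mulrNz.
(* From here on s is minimal at the level l. *)
have {s sk dep} [l [s [lk sk [m0 [j0 [m0l xs]]] min]]] :
    exists l s, [/\ (k + 2 <= l <= (k + 2) ^ (k + 1))%N, (0 < s <= k)%N, dependent l s &
      forall r, (0 < r < s)%N -> ~ dependent ((k + 2) * l) r].
  have /andP[s0 sk'] := sk.
  have [l [s' [/andP[l1 l2] s'1 d mn]]] := dependent_stable s0 dep.
  exists l, s'; split=> //; last by lia.
  apply/andP; split=> //; apply: (leq_trans l2).
  by rewrite -expnS addn1 leq_exp2l ?ltnS //; lia.
have /andP[s0 sk'] := sk; have /andP[l1 l2] := lk.
have [y Qy ys] := Qdiv m0 j0 s sk; exists y => // m j mk.
have {}xs : x *~ s = zG *~ j0 - lin n m0 a 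
  by rewrite -xs addrAC subrr add0r.
have {}ys : y *~ s = zH *~ j0 - lin n m0 b by [].
have sne : (s : int) != 0 by lia.
pose q := (m 0%N %/ s)%Z; pose r := (m 0%N %% s)%Z.
have rge : 0 <= r by apply: modz_ge0.
have rlt : r < s by rewrite -[X in _ < X]gez0_abs ?ltz_mod //; lia.
have mE : m 0%N = q * s + r := divz_eq _ _.
clearbody q r.
(* The relation (m, j) reduced modulo the relation (m0, j0) of exponent s. *)
pose m1 i := m i.+1 - q * m0 i; pose j1 := j - q * j0.
have red (V : zmodType) (z w : V) (c : nat -> V) : w *~ s = z *~ j0 - lin n m0 c ->
    lin n.+1 m (scons w c) = z *~ j <-> lin n m1 c + w *~ r = z *~ j1.
  move=> ws; rewrite lin_scons mE.
  have -> : lin n m1 c = lin n (fun i => m i.+1) c - lin n m0 c *~ q.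
    by rewrite -mulrNz -linM -linD; congr lin; apply: funext => i; rewrite mulNr.
  rewrite /j1 mulrzBr mulrzDr [q * s]mulrC (mulrzA w) ws mulrzBl -mulrzA [j0 * q]mulrC.
  set A := w *~ r; set B := z *~ _; set C := lin n m0 c *~ q; set L := lin n _ c.
  have -> : B - C + A + L = L - C + A + B.
    by rewrite (addrC _ L) addrA (addrC B) addrA (addrAC _ B).
  by split=> [<-|E]; [rewrite addrK | rewrite E subrK].
rewrite !red //.
have qk : (`|q| <= k)%N.
  have := mk 0%N isT; rewrite mE; nia.
have m1b : bounded n ((k + 2) * l) m1.
  move=> i ni; have := mk i.+1 ni; have := m0l i ni; rewrite /m1.
  move=> h1 h2; have : (`|(q * m0 i)%R| <= k * l)%N by rewrite abszM leq_mul.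
  by nia.
have Kl : ((k + 2) * ((k + 2) * l) <= (k + 2) ^ (k + 3))%N.
  rewrite (_ : k + 3 = (k + 1).+2)%N; last lia.
  by rewrite !expnS !leq_mul2l l2 !orbT.
clearbody m1 j1.
have [r0|rn0] := eqVneq r 0.
  rewrite r0 !mulr0z !addr0; apply: ab => i ni; apply: leq_trans (m1b i ni) _.
  by apply: leq_trans Kl; rewrite leq_pmull //; lia.
have rr : (0 < `|r| < s)%N by lia.
have rk : (`|r| <= k)%N by lia.
have rE : r = `|r|%N by lia.
have notx j' : lin n m1 a + x *~ r <> zG *~ j'.
  by rewrite rE => E; apply: (min `|r|%N) => //; exists m1, j'.
split=> E; exfalso; first exact: notx E.
(* The s-th power of the reduced relation, with x^s eliminated. *)
pose m2 i := s%:Z * m1 i - r * m0 i.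
pose j2 := s%:Z * j1 - r * j0.
have m2b : bounded n ((k + 2) ^ (k + 3)) m2.
  move=> i ni; apply: leq_trans Kl; have := m1b i ni; have := m0l i ni; rewrite /m2 => h1 h2.
  have : (`|(s%:Z * m1 i)%R| <= k * ((k + 2) * l))%N by rewrite abszM leq_mul.
  have : (`|(r * m0 i)%R| <= k * l)%N by rewrite abszM leq_mul.
  nia.
have m2E (V : zmodType) (z w : V) (c : nat -> V) : w *~ s = z *~ j0 - lin n m0 c ->
    (lin n m1 c + w *~ r - z *~ j1) *~ s = lin n m2 c - z *~ j2.
  move=> ws; have -> : lin n m2 c = lin n m1 c *~ s - lin n m0 c *~ r.
    by rewrite -mulrNz -!linM -linD; congr lin; apply: funext => i; rewrite mulNr.
  rewrite /j2 mulrzBl mulrzDl -(mulrzA w) [r * s]mulrC (mulrzA w) ws mulrzBl mulrzBr opprB.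
  rewrite -!mulrzA [j0 * r]mulrC [j1 * s]mulrC.
  set A := lin n m1 c *~ s; set B := z *~ (r * _); set C := lin n m0 c *~ r; set L := z *~ _.
  by rewrite (addrC B) !addrA.
have /(ab m2 j2 m2b) Ea : lin n m2 b = zH *~ j2.
  by apply/eqP; rewrite -subr_eq0 -(m2E _ _ y) // E subrr mul0rz.
have [|t Et] := torG (lin n m1 a + x *~ r - zG *~ j1).
  have /dvdnP[d ->] := kD s sk.
  have E0 := m2E _ zG x a xs; rewrite Ea subrr in E0.
  by rewrite mulnC mulrnA (pmulrn _ s) E0 mul0rn.
apply: (notx (t + j1)).
by rewrite mulrzDr -Et subrK.
Qed.
End Forth.

(** * Transfer of formulas between groups with zero *)

(** Zero is sent to the neutral element, so that it drops out of all
    relations; which elements are zero is recorded by [same_shape]. *)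
Definition unit_part (G : zmodType) (o : option G) : G := odflt 0 o.

Definition with_zero (G : zmodType) (om : nat -> G) : structure :=
  @Structure (option G)
    (fun x y => if x is Some u then if y is Some v then Some (u + v) else None else None)
    (omap (@GRing.opp G)) None (Some 0) (fun k => Some (om k)).

(** Satisfaction with each quantifier restricted to a set that depends on the
    Goedel number of the quantified formula.  That number serves as a clock:
    quantifiers that were passed earlier have larger Goedel numbers. *)
Fixpoint sat_in (M : structure) (P : nat -> M -> Prop) (e : nat -> M)
    (phi : formula) : Prop :=
  match phi with
  | Eq t u => eval e t = eval e u
  | Bot => False
  | Imp phi psi => sat_in P e phi -> sat_in P e psi
  | All psi => forall x : M, P (fcode (All psi)) x -> sat_in P (scons x e) psi
  end.

Lemma sat_in_full (M : structure) (P : nat -> M -> Prop) (e : nat -> M) phi :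
  (forall c x, P c x) -> sat_in P e phi <-> sat e phi.
Proof.
move=> Pfull; elim: phi e => //= [phi IH psi IH' | phi IH] e.
  by rewrite IH IH'.
by split=> + x => /(_ x) h => [|_]; apply/IH/h.
Qed.

(** How far two tuples have to agree in order to satisfy the same formulas of
    Goedel number c: each quantifier costs one step of [group_forth], and the
    exponents in a term are bounded by its Goedel number. *)
Definition level (c : nat) : nat := iter c (fun k => (k + 2) ^ (k + 3))%N 0%N.

Lemma level_mono : {homo level : c c' / (c <= c')%N}.
Proof.
move=> c c' /subnKC <-; elim: (c' - c)%N => [|d IH]; first by rewrite addn0.
by rewrite addnS; apply: leq_trans IH (ltnW (leq_step _)).
Qed.

Lemma leq_level c : (c <= level c)%N.
Proof. by elim: c => // c IH; apply: leq_ltn_trans IH (leq_step _). Qed.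

Lemma code_cons_gt x s : (x + CodeSeq.code s < CodeSeq.code (x :: s))%N.
Proof.
rewrite /= -/(CodeSeq.code s); have := ltn_expl x (isT : 1 < 2)%N; nia.
Qed.

Lemma code_cons2_gt x y : (y < CodeSeq.code [:: x; y])%N.
Proof. have := code_cons_gt x [:: y]; have := code_cons_gt y [::]; lia. Qed.

Lemma code_cons3_gt x y z : (y + z < CodeSeq.code [:: x; y; z])%N.
Proof.
have := code_cons_gt x [:: y; z]; have := code_cons_gt y [:: z].
have := code_cons_gt z [::]; lia.
Qed.

(** What the player who answers with elements of G needs: a decreasing chain
    of subgroups such that, over parameters from layer c + 1, roots and
    sufficiently independent elements are found in layer c.  N bounds the
    exponents, C the layers that are used. *)
Record filtration (G : zmodType) (z : G) (N C : nat) (P : nat -> G -> Prop) : Prop :=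
  Filtration {
  filt_torsion : exists2 D, (forall s, (0 < s <= N)%N -> (s %| D)%N) &
      forall u : G, u *+ D = 0 -> exists j : int, u = z *~ j;
  filt_unit : forall c, (c <= C.+1)%N -> P c z;
  filt_sub : forall c u v, P c u -> P c v -> P c (u - v);
  filt_mono : forall c u, P c.+1 u -> P c u;
  filt_div : forall c s u, (c <= C)%N -> (0 < s <= N)%N -> P c.+1 u ->
    exists2 v, P c v & v *+ s = u;
  filt_ind : forall c n k a, (c <= C)%N -> (k <= N)%N ->
    (forall i, (i < n)%N -> P c.+1 (a i)) ->
    exists2 y, P c y & forall s m (j : int), (0 < s <= k)%N -> bounded n k m ->
      lin n m a + y *+ s <> z *~ j
}.

Section FiltrationTheory.
Variables (G : zmodType) (z : G) (N C : nat) (P : nat -> G -> Prop).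
Hypothesis FP : filtration z N C P.

Lemma filt_0 c : (c <= C.+1)%N -> P c 0.
Proof. by move=> cC; rewrite -(subrr z); apply: (filt_sub FP); apply: (filt_unit FP). Qed.

Lemma filt_opp c u : (c <= C.+1)%N -> P c u -> P c (- u).
Proof. by move=> cC Pu; rewrite -sub0r; apply: (filt_sub FP) => //; apply: filt_0. Qed.

Lemma filt_add c u v : (c <= C.+1)%N -> P c u -> P c v -> P c (u + v).
Proof.
by move=> cC Pu Pv; rewrite -[v]opprK; apply: (filt_sub FP) => //; apply: filt_opp.
Qed.

Lemma filt_mulz c u (j : int) : (c <= C.+1)%N -> P c u -> P c (u *~ j).
Proof.
move=> cC Pu; have Pn n : P c (u *+ n).
  by elim: n => [|n IH]; [apply: filt_0 | rewrite mulrS; apply: filt_add].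
by case: j => n; [exact: (Pn n) | rewrite NegzE mulrNz; exact: (filt_opp cC (Pn _))].
Qed.

Lemma filt_lin c n m a : (c <= C.+1)%N -> (forall i, (i < n)%N -> P c (a i)) ->
  P c (lin n m a).
Proof.
move=> cC Pa; rewrite /lin; elim/big_ind: _ => [||i _].
- exact: filt_0.
- by move=> u v; apply: filt_add.
- by apply: filt_mulz => //; apply: Pa.
Qed.

Lemma filt_le c d u : (c <= d)%N -> P d u -> P c u.
Proof.
by move=> /subnKC<-; elim: (d - c)%N => [|e IH]; rewrite ?addn0 // addnS => /(filt_mono FP).
Qed.

End FiltrationTheory.

Lemma agree_sym (G H : zmodType) (zG : G) (zH : H) n k a b :
  agree zG zH n k a b -> agree zH zG n k b a.
Proof. by move=> ab m j mk; split=> /(ab m j mk). Qed.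

Lemma agree_le (G H : zmodType) (zG : G) (zH : H) n k l a b :
  (k <= l)%N -> agree zG zH n l a b -> agree zG zH n k a b.
Proof.
by move=> kl ab m j mk; apply: ab => i ni; apply: leq_trans (mk i ni) kl.
Qed.

Lemma unit_part_scons (G : zmodType) x (a : nat -> option G) :
  (fun i => unit_part (scons x a i)) = scons (unit_part x) (fun i => unit_part (a i)).
Proof. by apply: funext => -[]. Qed.

Definition same_shape (G H : zmodType) n (a : nat -> option G) (b : nat -> option H) :=
  forall i, (i < n)%N -> isSome (a i) = isSome (b i).

Definition same_type (G H : zmodType) (zG : G) (zH : H) n k a b : Prop :=
  same_shape n a b /\ agree zG zH n k (fun i => unit_part (a i)) (fun i => unit_part (b i)).

Lemma same_type_sym (G H : zmodType) (zG : G) (zH : H) n k a b :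
  same_type zG zH n k a b -> same_type zH zG n k b a.
Proof. by case=> ab /agree_sym ab'; split=> // i ni; rewrite ab. Qed.

(** A move to zero is answered by zero, the other moves by [group_forth]. *)
Lemma same_type_forth (G H : zmodType) (zG : G) (zH : H) N C P Q c n k a b x :
  filtration zG N C P -> filtration zH N C Q ->
  (c <= C)%N -> (k <= N)%N ->
  (forall i, (i < n)%N -> Q c.+1 (unit_part (b i))) ->
  same_type zG zH n ((k + 2) ^ (k + 3)) a b ->
  exists2 y, Q c (unit_part y) & same_type zG zH n.+1 k (scons x a) (scons y b).
Proof.
move=> FP FQ cC kN Qb [shape ab].
have shape_cons y : isSome x = isSome y -> same_shape n.+1 (scons x a) (scons y b).
  by move=> xy -[|i] //=; apply: shape.
case: x shape_cons => [x|] shape_cons; last first.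
  exists None; first by apply: (filt_0 FQ); lia.
  split; first exact: shape_cons.
  rewrite !unit_part_scons => m j mk; rewrite !lin_scons !mul0rz !add0r.
  by apply: ab => i ni; apply: leq_trans (mk i.+1 ni) (ltnW (leq_step _)).
have [D ND torG] := filt_torsion FP.
have [s sk||//|y Qy xy] := group_forth x (Q := Q c) torG _ ab.
- by apply: ND; lia.
- move=> m j s sk; apply: (filt_div FQ); [lia|lia|].
  apply: (filt_sub FQ); first by apply: (filt_mulz FQ); [lia|apply: (filt_unit FQ); lia].
  by apply: (filt_lin FQ) => //; lia.
- exact: (filt_ind FQ).
exists (Some y) => //; split; first exact: shape_cons.
by rewrite !unit_part_scons.
Qed.

Section Transfer.
Variables (G H : zmodType) (zG : G) (zH : H) (omG : nat -> G) (omH : nat -> H).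
Variables (N C : nat) (P : nat -> G -> Prop) (Q : nat -> H -> Prop).
Hypothesis FP : filtration zG N C P.
Hypothesis FQ : filtration zH N C Q.
Hypothesis om_z : forall k, (k <= C)%N -> exists j : int, omG k = zG *~ j /\ omH k = zH *~ j.
Hypothesis level_N : (level C <= N)%N.

Let MG := with_zero omG.
Let MH := with_zero omH.

(** A term without zero factor denotes a monomial in the variables times
    a root of unity, the same one for both interpretations. *)
Lemma eval_lin n (a : nat -> MG) (b : nat -> MH) t :
  same_shape n a b -> term_below n t -> (tcode t <= C)%N ->
  (eval a t = None /\ eval b t = None) \/
  exists m j, [/\ bounded n (tcode t) m,
    eval a t = Some (lin n m (fun i => unit_part (a i)) + zG *~ j) &
    eval b t = Some (lin n m (fun i => unit_part (b i)) + zH *~ j)].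
Proof.
move=> ab; have lin0 (V : zmodType) (c : nat -> V) : lin n (fun=> 0) c = 0.
  by rewrite /lin big1 // => i _; rewrite mulr0z.
elim: t => [i|t IH u IH'|t IH|||k].
- move=> ni _; have := ab i ni; rewrite /=.
  case Ea: (a i) => [x|]; case Eb: (b i) => [y|] //= _; last by left.
  right; exists (fun l => (l == i)%:R), 0.
  have linE (V : zmodType) (c : nat -> V) : lin n (fun l => (l == i)%:R) c = c i.
    rewrite /lin (bigD1 (Ordinal ni)) //= eqxx mulr1z big1 ?addr0 // => l.
    by rewrite -val_eqE /= => /negPf->; rewrite mulr0z.
  split; rewrite ?linE ?mulr0z ?addr0 ?Ea ?Eb // => l _.
  have := code_cons2_gt 0 i; rewrite /=; case: (l == i) => /=; lia.
- move=> /andP[nt nu] tuC.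
  have tu : (tcode t + tcode u < tcode (Mul t u))%N := code_cons3_gt 1 _ _.
  have [tC uC] : (tcode t <= C)%N /\ (tcode u <= C)%N by lia.
  case: (IH nt tC) => [[Ea Eb]|[m [j [mb Ea Eb]]]]; first by left; rewrite /= Ea Eb.
  case: (IH' nu uC) => [[Ea' Eb']|[m' [j' [mb' Ea' Eb']]]].
    by left; rewrite /= Ea Eb Ea' Eb'.
  right; exists (fun i => m i + m' i), (j + j'); split.
  + by move=> i ni; have := mb i ni; have := mb' i ni; lia.
  + by rewrite /= Ea Ea' linD mulrzDr addrACA.
  + by rewrite /= Eb Eb' linD mulrzDr addrACA.
- move=> nt ntC.
  have tC' : (tcode t < tcode (Inv t))%N := code_cons2_gt 2 _.
  have tC : (tcode t <= C)%N by lia.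
  case: (IH nt tC) => [[Ea Eb]|[m [j [mb Ea Eb]]]]; first by left; rewrite /= Ea Eb.
  right; exists (fun i => -1 * m i), (- j); split.
  + by move=> i ni; have := mb i ni; rewrite mulN1r abszN; lia.
  + by rewrite /= Ea /= linM mulrN1z mulrNz opprD.
  + by rewrite /= Eb /= linM mulrN1z mulrNz opprD.
- by left.
- by right; exists (fun=> 0), 0; split; rewrite //= lin0 mulr0z addr0.
- move=> _ kC; have kt : (k < tcode (Omega k))%N := code_cons2_gt 5 _.
  have [|j [EG EH]] := om_z (k := k); first by lia.
  by right; exists (fun=> 0), j; split; rewrite //= lin0 add0r ?EG ?EH.
Qed.

(** The Ehrenfeucht-Fraisse argument.  Parameters of a formula of Goedel
    number c come from layers above c, as they were chosen by quantifiers with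
    larger Goedel numbers. *)
Lemma transfer phi n (a : nat -> MG) (b : nat -> MH) :
  formula_below n phi -> (fcode phi <= C)%N ->
  (forall i, (i < n)%N -> P (fcode phi).+1 (unit_part (a i))) ->
  (forall i, (i < n)%N -> Q (fcode phi).+1 (unit_part (b i))) ->
  same_type zG zH n (level (fcode phi)) a b ->
  sat_in (M := MG) (fun c x => P c (unit_part x)) a phi <->
  sat_in (M := MH) (fun c x => Q c (unit_part x)) b phi.
Proof.
elim: phi n a b => [t u||phi IH psi IH'|phi IH] n a b.
- move=> /andP[nt nu] tuC _ _ [shape ab].
  have tu : (tcode t + tcode u < fcode (Eq t u))%N := code_cons3_gt 0 _ _.
  have [tC uC] : (tcode t <= C)%N /\ (tcode u <= C)%N by lia.
  rewrite /=; case: (eval_lin shape nt tC) => [[-> ->]|[m [j [mb -> ->]]]];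
    case: (eval_lin shape nu uC) => [[-> ->]|[m' [j' [mb' -> ->]]]] //.
  have E (V : zmodType) (z : V) (c : nat -> V) :
      Some (lin n m c + z *~ j) = Some (lin n m' c + z *~ j') <->
      lin n (fun i => m i + -1 * m' i) c = z *~ (j' - j).
    rewrite linD linM mulrN1z mulrzBr; split=> [[E]|E].
      by apply/eqP; rewrite subr_eq addrAC eq_sym subr_eq eq_sym E addrC.
    by rewrite -(subrK (lin n m' c) (lin n m c)) E addrAC subrK addrC.
  rewrite !E; apply: ab => i ni; have := mb i ni; have := mb' i ni.
  by have := leq_level (fcode (Eq t u)); rewrite mulN1r; lia.
- by [].
- move=> /andP[n1 n2] tuC Pa Qb [shape ab].
  have tu : (fcode phi + fcode psi < fcode (Imp phi psi))%N := code_cons3_gt 2 _ _.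
  rewrite /= (IH n a b) ?(IH' n a b) //; try lia.
  + by move=> i ni; apply: (filt_le FP) (Pa i ni); lia.
  + by move=> i ni; apply: (filt_le FQ) (Qb i ni); lia.
  + by split=> //; apply: agree_le ab; apply: level_mono; lia.
  + by move=> i ni; apply: (filt_le FP) (Pa i ni); lia.
  + by move=> i ni; apply: (filt_le FQ) (Qb i ni); lia.
  + by split=> //; apply: agree_le ab; apply: level_mono; lia.
- set c := fcode _ => nphi cC Pa Qb [shape ab].
  have phic : (fcode phi < c)%N by exact: code_cons2_gt.
  have sim : same_type zG zH n ((level (fcode phi) + 2) ^ (level (fcode phi) + 3)) a b.
    by split=> //; apply: agree_le ab; apply: (level_mono phic).
  have kN : (level (fcode phi) <= N)%N.
    by apply: leq_trans level_N; apply: level_mono; lia.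
  have env (V : zmodType) (R : nat -> V -> Prop) (z : V) (d : nat -> option V) w :
      filtration z N C R -> (forall i, (i < n)%N -> R c.+1 (unit_part (d i))) ->
      R c (unit_part w) ->
      forall i, (i < n.+1)%N -> R (fcode phi).+1 (unit_part (scons w d i)).
    move=> FR Rd Rw [_|i ni] /=; first exact: (filt_le FR) Rw.
    by apply: (filt_le FR) (Rd i ni); lia.
  split=> h w Rw.
    have [x Px sxy] := same_type_forth w FQ FP cC kN Pa (same_type_sym sim).
    apply/(IH n.+1 (scons x a))/h; rewrite //; first by lia.
    + exact: env FP Pa Px.
    + exact: env FQ Qb Rw.
    + exact: same_type_sym.
  have [y Qy sxy] := same_type_forth w FP FQ cC kN Qb sim.
  apply/(IH n.+1 _ (scons y b))/h; rewrite //; first by lia.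
  + exact: env FP Pa Rw.
  + exact: env FQ Qb Qy.
Qed.
End Transfer.

Lemma mulz_mod (G : zmodType) (z : G) (D : nat) (j : int) :
  (0 < D)%N -> z *+ D = 0 -> z *~ j = z *+ `|(j %% D)%Z|.
Proof.
move=> D0 zD; rewrite {1}(divz_eq j D) mulrzDr mulrC mulrzA -(pmulrn z D) zD.
by rewrite mul0rz add0r pmulrn gez0_abs // modz_ge0 //; lia.
Qed.

Lemma ltn_modz (D : nat) (j : int) : (0 < D)%N -> (`|(j %% D)%Z| < D)%N.
Proof.
by have := ltz_mod j (d := D%:Z); have := modz_ge0 j (d := D%:Z); lia.
Qed.

(** For each exponent s and each right hand side, at most one of the first
    multiples of an element t of large order is a solution.  There are finitely
    many equations, so enough multiples leave one that solves none. *)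
Lemma avoid_finite (G : zmodType) (z : G) (D n k : nat) (a : nat -> G) :
  z *+ D = 0 -> (0 < D)%N ->
  (forall q, exists t : G, forall d, t *+ d = 0 -> (q.+1 %| d)%N) ->
  exists y, forall s m (j : int), (0 < s <= k)%N -> bounded n k m ->
     lin n m a + y *+ s <> z *~ j.
Proof.
move=> zD D0 big_order.
pose I : finType := ('I_k.+1 * {ffun 'I_n -> 'I_(k + k).+1} * 'I_D)%type.
pose r := #|I|.+1.
have [t tq] := big_order (k * r)%N.
apply: contrapT => none.
have distinct s i i' : (0 < s <= k)%N -> (i < i' < r)%N -> t *+ i *+ s <> t *+ i' *+ s.
  move=> sk ir E; have /tq /dvdn_leq : t *+ ((i' - i) * s) = 0.
    by rewrite mulrnA mulrnBr ?mulrnBl ?E ?subrr //; lia.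
  have : ((i' - i) * s <= k * r)%N by rewrite mulnC leq_mul //; lia.
  have : (0 < (i' - i) * s)%N by rewrite muln_gt0; lia.
  by lia.
(* A bad multiple is charged to its equation; exponents are shifted by k. *)
have all_bad (i : 'I_r) : exists u : I, (0 < u.1.1)%N /\
    \sum_(l < n) a l *~ ((u.1.2 l)%:Z - k%:Z) + t *+ i *+ u.1.1 = z *+ u.2.
  apply: contrapT => ni; apply: none; exists (t *+ i) => s m j sk mk E; apply: ni.
  have sk' : (s < k.+1)%N by lia.
  exists (Ordinal sk', [ffun l : 'I_n => inord `|(m l + k%:Z)%R|%N],
          Ordinal (ltn_modz j D0)).
  split=> /=; first by lia.
  rewrite -(mulz_mod j D0 zD) -E; congr (_ + _); rewrite /lin.
  apply: eq_bigr => l _; congr (_ *~ _).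
  rewrite ffunE inordK; have := mk l (ltn_ord l); lia.
have [f fP] := choice all_bad.
have finj : injective f.
  move=> i i' ff; have [s0 E] := fP i; have [_ E'] := fP i'; rewrite -ff -E in E'.
  move: E' => /addrI E'; have sk : (0 < (f i).1.1 <= k)%N by rewrite s0 -ltnS /=.
  apply: val_inj; case: (ltngtP i i') => //= ii'; exfalso.
    by apply: (distinct _ i i' sk) => //; rewrite ii' /=.
  by apply: (distinct _ i' i sk) => //; rewrite ii' /=.
have := leq_card _ finj; rewrite card_ord /r; lia.
Qed.

Lemma filtration_full (G : zmodType) (z : G) (D N C : nat) :
  (0 < D)%N -> z *+ D = 0 ->
  (forall s, (0 < s <= N)%N -> (s %| D)%N) ->
  (forall u : G, u *+ D = 0 -> exists j : int, u = z *~ j) ->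
  (forall s (u : G), (0 < s)%N -> exists v, v *+ s = u) ->
  (forall q, exists t : G, forall d, t *+ d = 0 -> (q.+1 %| d)%N) ->
  filtration z N C (fun _ _ => True).
Proof.
move=> D0 zD ND tor div big; split=> //.
- by exists D.
- by move=> c s u _ /andP[s0 _] _; have [v] := div s u s0; exists v.
- move=> c n k a _ _ _; have [y yP] := avoid_finite n k a zD D0 big.
  by exists y.
Qed.

Local Close Scope ring_scope.

(** * Semantic content of the axioms *)

Definition mpow (M : structure) (x : M) (n : nat) : M := iterop n (@mul_of M) x (one_of M).

Lemma eval_tpow (M : structure) (e : nat -> M) t n :
  eval e (tpow t n) = mpow (eval e t) n.
Proof.
rewrite /tpow /mpow; case: n => // n; rewrite !iteropS.
by elim: n => //= n <-.
Qed.

Lemma sat_And (M : structure) (e : nat -> M) phi psi :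
  sat e (And phi psi) <-> sat e phi /\ sat e psi.
Proof.
split=> /= [h|[h h']]; last by apply.
by split; apply: contrapT => n; apply: h => h1 // h2.
Qed.

Lemma sat_Or (M : structure) (e : nat -> M) phi psi :
  sat e (Or phi psi) <-> sat e phi \/ sat e psi.
Proof.
split=> /= [h|[h n|h _]] //.
by have [|n] := pselect (sat e phi); [left|right; apply: h].
Qed.

Lemma sat_Ex (M : structure) (e : nat -> M) phi :
  sat e (Ex phi) <-> exists x, sat (scons x e) phi.
Proof.
split=> [h|[x h] /(_ x)]; last exact.
by apply: contrapT => n; apply: h => x h; apply: n; exists x.
Qed.

Lemma sat_Conj (M : structure) (e : nat -> M) s :
  sat e (Conj s) <-> forall phi, List.In phi s -> sat e phi.
Proof.
elim: s => [|phi s IH]; first by split=> //= _ [].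
rewrite sat_And IH; split=> [[h h'] psi /= [<-|/h']|h] //.
by split=> [|psi ins]; apply: h; [left|right].
Qed.

Lemma sat_Disj (M : structure) (e : nat -> M) s :
  sat e (Disj s) <-> exists2 phi, List.In phi s & sat e phi.
Proof.
elim: s => [|phi s IH]; first by split=> //= -[].
rewrite sat_Or IH; split=> [[h|[psi ins h]]|[psi /= [->|ins h]]]; last 1 first.
- by right; exists psi.
- by exists phi => //; left.
- by exists psi => //; right.
- by left.
Qed.

HB.instance Definition _ := gen_eqMixin formula.

Lemma In_mem (T : eqType) (x : T) s : List.In x s <-> x \in s.
Proof.
elim: s => //= y s IH; rewrite inE; split.
  by case=> [->|/IH->]; rewrite ?eqxx ?orbT.
by case/orP=> [/eqP->|/IH]; [left|right].
Qed.

Lemma models_All (M : structure) phi :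
  models M (All phi) <-> forall (e : nat -> M) x, sat (scons x e) phi.
Proof. by []. Qed.

Section AxiomContent.
Variable M : structure.

Lemma models_M6 k : models M (Conj [seq Neq (tpow (Omega k) i) (tpow (Omega k) j)
       | j <- iota 0 k.+2, i <- iota 0 j]) <->
  forall i j, i < j < k.+2 -> mpow (omega_of M k) i <> mpow (omega_of M k) j.
Proof.
set s := [seq _ | j <- _, i <- _].
split=> [h i j /andP[ij jk]|h e].
  have /sat_Conj/(_ (Neq (tpow (Omega k) i) (tpow (Omega k) j))) := h (fun=> one_of M).
  rewrite [sat _ _]/= !eval_tpow; apply; apply/In_mem/allpairsPdep.
  by exists j, i; rewrite !mem_iota.
apply/sat_Conj => phi /In_mem /allpairsPdep[j [l]]; rewrite !mem_iota /= !add0n => -[jk lj ->].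
by rewrite /= !eval_tpow; apply: h; rewrite lj.
Qed.

Lemma models_M7 k : models M (All
    (Iff (Eq (tpow (Var 0) k.+2) One)
         (Disj [seq Eq (Var 0) (tpow (Omega k) i) | i <- iota 0 k.+2]))) <->
  forall x : M, mpow x k.+2 = one_of M <->
    exists2 i, i < k.+2 & x = mpow (omega_of M k) i.
Proof.
set s := [seq _ | i <- _].
have E (e : nat -> M) : sat e (Disj s) <-> exists2 i, i < k.+2 & e 0 = mpow (omega_of M k) i.
  rewrite sat_Disj; split=> [[phi /In_mem/mapP[j]]|[j jk ej]].
    by rewrite mem_iota /= add0n => jk -> /=; rewrite eval_tpow; exists j.
  exists (Eq (Var 0) (tpow (Omega k) j)); last by rewrite /= eval_tpow.
  by apply/In_mem/map_f; rewrite mem_iota.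
split=> [h x|h]; last (apply/models_All => e x).
  have [h1 h2] := proj1 (sat_And _ _ _) (proj1 (models_All _ _) h (fun=> x) x); split.
    by move=> h3; apply/(E (scons x (fun=> x)))/h1; rewrite /sat eval_tpow.
  by move=> /(E (scons x (fun=> x)))/h2; rewrite /sat eval_tpow.
apply/sat_And; split.
  by move=> h1; apply/E/h; move: h1; rewrite /sat eval_tpow.
by move=> /E/h h1; rewrite /sat eval_tpow.
Qed.

Lemma models_M8 k : models M (All (Ex (Eq (tpow (Var 0) k.+2) (Var 1)))) <->
  forall x : M, exists y, mpow y k.+2 = x.
Proof.
split=> [h x|h]; last (apply/models_All => e x).
  have [y] := proj1 (sat_Ex _ _) (proj1 (models_All _ _) h (fun=> x) x).
  by rewrite /sat eval_tpow => E; exists y.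
by apply/sat_Ex; have [y yx] := h x; exists y; rewrite /sat eval_tpow.
Qed.

End AxiomContent.

Lemma tpow_below k t n : term_below k t -> term_below k (tpow t n).
Proof.
rewrite /tpow; case: n => // n tk.
by rewrite iteropS; elim: n => //= n ->; rewrite tk.
Qed.

Lemma Conj_below k s :
  (forall phi, phi \in s -> formula_below k phi) -> formula_below k (Conj s).
Proof.
elim: s => //= phi s IH h; rewrite h ?mem_head //= IH // => psi ins.
by apply: h; rewrite inE ins orbT.
Qed.

Lemma Disj_below k s :
  (forall phi, phi \in s -> formula_below k phi) -> formula_below k (Disj s).
Proof.
elim: s => //= phi s IH h; rewrite h ?mem_head //= IH // => psi ins.
by apply: h; rewrite inE ins orbT.
Qed.

Lemma All_below k phi : formula_below k (All phi) = formula_below k.+1 phi.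
Proof. by []. Qed.

Lemma Iff_below k phi psi :
  formula_below k phi -> formula_below k psi -> formula_below k (Iff phi psi).
Proof. by move=> /= -> ->. Qed.

Lemma mul_axiom_sentence phi : mul_axiom phi -> sentence phi.
Proof.
case=> // k; rewrite /sentence.
- apply: Conj_below => psi /allpairsPdep[j [l [_ _ ->]]] /=.
  by rewrite !tpow_below.
- rewrite All_below; apply: Iff_below; first by apply/andP; split=> //; apply: tpow_below.
  by apply: Disj_below => psi /mapP[j _ ->]; apply/andP; split=> //; apply: tpow_below.
- suff : formula_below 2 (Eq (tpow (Var 0) k.+2) (Var 1)) by rewrite /= => ->.
  by apply/andP; split=> //; apply: tpow_below.
Qed.

(** * The group of nonzero elements of a model *)

Definition mul_model (M : structure) : Prop := forall phi, mul_axiom phi -> models M phi.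

(** The proof that M is a model is a parameter of the type because the group
    structure on it depends on this proof. *)
Definition unit_group_of (M : structure) (MT : mul_model M) : Type :=
  {x : M | x <> zero_of M}.

Section UnitGroup.
Variable M : structure.
Hypothesis MT : mul_model M.
Notation unit_group := (unit_group_of MT).

Local Notation mul := (@mul_of M).
Local Notation zero := (zero_of M).
Local Notation one := (one_of M).

Lemma mulA_model (x y z : M) : mul x (mul y z) = mul (mul x y) z.
Proof. exact: (MT M1 (fun=> zero) x y z). Qed.

Lemma mulC_model (x y : M) : mul x y = mul y x.
Proof. exact: (MT M4 (fun=> zero) x y). Qed.

Lemma mul1_model (x : M) : mul one x = x.
Proof. by rewrite mulC_model; exact: (MT M2 (fun=> zero) x). Qed.

Lemma mulV_model (x : M) : x <> zero -> mul (inv_of x) x = one.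
Proof. by rewrite mulC_model; exact: (MT M3 (fun=> zero) x). Qed.

Lemma mul0_model (x : M) : mul zero x = zero.
Proof.
rewrite mulC_model.
by have [] := proj1 (sat_And _ _ _) (proj1 (models_All _ _) (MT M5) (fun=> zero) x).
Qed.

Lemma inv0_model : inv_of zero = zero.
Proof.
by have [] := proj1 (sat_And _ _ _) (proj1 (models_All _ _) (MT M5) (fun=> zero) zero).
Qed.

Lemma one_neq0_model : one <> zero.
Proof.
move=> E; have all0 x : x = zero by rewrite -(mul1_model x) E mul0_model.
apply: (proj1 (models_M6 M 0) (MT (M6 0)) 0 1) => //.
by rewrite [LHS]all0 [RHS]all0.
Qed.

Lemma mul_neq0_model (x y : M) : x <> zero -> y <> zero -> mul x y <> zero.
Proof.
move=> x0 y0 E; apply: y0.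
by rewrite -(mul1_model y) -(mulV_model x0) -mulA_model E mulC_model mul0_model.
Qed.

Lemma inv_neq0_model (x : M) : x <> zero -> inv_of x <> zero.
Proof.
move=> x0 E; apply: one_neq0_model.
by rewrite -(mulV_model x0) E mul0_model.
Qed.

HB.instance Definition _ := gen_eqMixin unit_group.
HB.instance Definition _ := gen_choiceMixin unit_group.

Definition unit_add (u v : unit_group) : unit_group :=
  exist _ (mul (sval u) (sval v)) (mul_neq0_model (svalP u) (svalP v)).
Definition unit_opp (u : unit_group) : unit_group :=
  exist _ (inv_of (sval u)) (inv_neq0_model (svalP u)).
Definition unit_zero : unit_group := exist _ one one_neq0_model.

Lemma unit_inj (u v : unit_group) : sval u = sval v -> u = v.
Proof. by case: u v => [x x0] [y y0] /= xy; apply: eq_exist. Qed.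

Fact unit_addA : associative unit_add.
Proof. by move=> u v w; apply/unit_inj/mulA_model. Qed.
Fact unit_addC : commutative unit_add.
Proof. by move=> u v; apply/unit_inj/mulC_model. Qed.
Fact unit_add0 : left_id unit_zero unit_add.
Proof. by move=> u; apply/unit_inj/mul1_model. Qed.
Fact unit_addN : left_inverse unit_zero unit_opp unit_add.
Proof. by move=> u; apply/unit_inj/mulV_model/(svalP u). Qed.

HB.instance Definition _ :=
  GRing.isZmodule.Build unit_group unit_addA unit_addC unit_add0 unit_addN.

Definition to_unit (x : M) : option unit_group :=
  if pselect (x = zero) is right h then Some (exist _ x h) else None.

Lemma to_unit_sval (u : unit_group) : to_unit (sval u) = Some u.
Proof.
rewrite /to_unit; case: pselect => [h|h]; first by case: (svalP u).
by congr Some; apply: unit_inj.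
Qed.

Lemma to_unit0 : to_unit zero = None.
Proof. by rewrite /to_unit; case: pselect. Qed.

Variant unit_spec (x : M) : option unit_group -> Prop :=
| UnitZero of x = zero : unit_spec x None
| UnitSome (u : unit_group) of x = sval u : unit_spec x (Some u).

Lemma to_unitP x : unit_spec x (to_unit x).
Proof. by rewrite /to_unit; case: pselect => h; constructor. Qed.

Lemma to_unit_inj : injective to_unit.
Proof. by move=> x y; case: to_unitP => [->|u ->]; case: to_unitP => [->|v ->] // [->]. Qed.

Lemma sval_mulrn (u : unit_group) n : sval (u *+ n)%R = mpow (sval u) n.
Proof.
case: n => // n; rewrite /mpow iteropS; elim: n => [|n IH]; first by rewrite mulr1n.
by rewrite mulrS /= -IH.
Qed.

Variable om : nat -> unit_group.

(** In the language of multiplication alone the interpretation [om] of the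
    roots of unity is free; otherwise it has to be that of M. *)
Lemma to_unit_eval (e : nat -> M) t :
  mul_term t \/ (forall k, to_unit (omega_of M k) = Some (om k)) ->
  to_unit (eval e t) = eval (M := with_zero om) (to_unit \o e) t.
Proof.
elim: t => /= [i _|t IH u IH'|t IH|||k]; last by case.
- by [].
- move=> h; rewrite -IH -?IH'; try by case: h => [/andP[]|]; by [left|right].
  case: (to_unitP (eval e t)) => [->|v ->]; first by rewrite mul0_model to_unit0.
  case: (to_unitP (eval e u)) => [->|w ->]; first by rewrite mulC_model mul0_model to_unit0.
  by rewrite -[mul_of _ _]/(sval (v + w)%R) to_unit_sval.
- move=> [//|h]; rewrite -IH; last by right.
  case: (to_unitP (eval e t)) => [->|v ->]; first by rewrite inv0_model to_unit0.
  by rewrite -[inv_of _]/(sval (- v)%R) to_unit_sval.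
- by move=> _; apply: to_unit0.
- by move=> _; rewrite -[one_of M]/(sval (0%R : unit_group)) to_unit_sval.
Qed.

Lemma to_unit_sat (e : nat -> M) phi :
  mul_formula phi \/ (forall k, to_unit (omega_of M k) = Some (om k)) ->
  sat e phi <-> sat (M := with_zero om) (to_unit \o e) phi.
Proof.
elim: phi e => //= [t u|phi IH psi IH'|phi IH] e h.
- rewrite -!to_unit_eval; try by case: h => [/andP[]|]; by [left|right].
  by split=> [->//|/to_unit_inj].
- by rewrite IH ?IH' //; case: h => [/andP[]|]; by [left|right].
- have E x : to_unit \o scons x e = scons (to_unit x) (to_unit \o e).
    by apply: funext => -[].
  split=> hx x; last by apply/IH => //; rewrite E; apply: hx.
  case: x => [u|]; first by rewrite -to_unit_sval -E -IH.
  by rewrite -to_unit0 -E -IH.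
Qed.

End UnitGroup.

Section UnitGroupTheory.
Variable M : structure.
Hypothesis MT : mul_model M.
Local Notation unit_group := (unit_group_of MT).
Local Open Scope ring_scope.

Lemma mpow0 n : mpow (zero_of M) n.+1 = zero_of M.
Proof. by rewrite /mpow iteropS; elim: n => //= n _; rewrite mul0_model. Qed.

Lemma omega_neq0 k : omega_of M k <> zero_of M.
Proof.
move=> E; have : mpow (omega_of M k) k.+2 = one_of M.
  by apply/(proj1 (models_M7 M k) (MT (M7 k))); exists 1%N.
by rewrite E mpow0 => /esym/(one_neq0_model MT).
Qed.

Definition unit_omega (k : nat) : unit_group := exist _ (omega_of M k) (@omega_neq0 k).

Lemma to_unit_omega k : to_unit MT (omega_of M k) = Some (unit_omega k).
Proof. by rewrite -[omega_of M k]/(sval (unit_omega k)) to_unit_sval. Qed.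

Lemma unit_torsion k (u : unit_group) :
  u *+ k.+2 = 0 <-> exists2 i, (i < k.+2)%N & u = unit_omega k *+ i.
Proof.
have := proj1 (models_M7 M k) (MT (M7 k)) (sval u); rewrite -sval_mulrn => uk.
split=> [E|[i ik E]].
  have [|i ik E'] := proj1 uk; first by rewrite E.
  by exists i => //; apply: unit_inj; rewrite E' sval_mulrn.
by apply/unit_inj/uk; exists i => //; rewrite E sval_mulrn.
Qed.

Lemma unit_omega_ord k d : unit_omega k *+ d = 0 <-> (k.+2 %| d)%N.
Proof.
have z0 : unit_omega k *+ k.+2 = 0 by apply/unit_torsion; exists 1%N.
split=> [|/dvdnP[q ->]]; last by rewrite mulnC mulrnA z0 mul0rn.
rewrite {1}(divn_eq d k.+2) mulnC mulrnDr mulrnA z0 mul0rn add0r /dvdn => E.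
case: posnP => // r0; have rk : (d %% k.+2 < k.+2)%N by rewrite ltn_mod.
have [] := proj1 (models_M6 M k) (MT (M6 k)) 0%N (d %% k.+2)%N; first by rewrite r0.
by rewrite -[omega_of M k]/(sval (unit_omega k)) -!sval_mulrn E.
Qed.

Lemma unit_omega_ordz k (j : int) : unit_omega k *~ j = 0 <-> (k.+2 %| `|j|)%N.
Proof.
rewrite -unit_omega_ord; case: j => n //.
rewrite NegzE mulrNz abszN; split=> [/eqP|E]; first by rewrite oppr_eq0 => /eqP.
by apply/eqP; rewrite oppr_eq0; apply/eqP.
Qed.

Lemma unit_div s (u : unit_group) : (0 < s)%N -> exists v, v *+ s = u.
Proof.
case: s => // -[|s] _; first by exists u.
have [y yE] := proj1 (models_M8 M s) (MT (M8 s)) (sval u).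
have y0 : y <> zero_of M by move=> y0; apply: (svalP u); rewrite -yE y0 mpow0.
exists (exist _ y y0 : unit_group).
by apply: unit_inj; rewrite sval_mulrn.
Qed.

Lemma unit_big_order q : exists t : unit_group, forall d, t *+ d = 0 -> (q.+1 %| d)%N.
Proof.
case: q => [|q]; first by exists 0 => d _; rewrite dvd1n.
by exists (unit_omega q) => d /unit_omega_ord.
Qed.

Lemma unit_filtration k N C : (forall s, (0 < s <= N)%N -> (s %| k.+2)%N) ->
  filtration (unit_omega k) N C (fun _ _ => True).
Proof.
move=> ND; apply: (@filtration_full _ _ k.+2) => //.
- by apply/unit_omega_ord.
- by move=> u /unit_torsion[i _ ->]; exists i.
- exact: unit_div.
- exact: unit_big_order.
Qed.

End UnitGroupTheory.

Lemma dvdn_bigfact N s : 0 < s <= N.+2 -> s %| N.+2`!.-2.+2.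
Proof.
have -> : N.+2`!.-2.+2 = N.+2`!.
  by have := fact_geq N.+2; case: (N.+2`!) => [|[|d]] //.
exact: dvdn_fact.
Qed.

(** All the omega_n are interpreted by 1 in both groups, which is harmless
    for multiplicative sentences.  The empty tuples agree because z has the same
    order in both models. *)
Lemma mul_elementary (M M' : structure) phi :
  mul_model M -> mul_model M' -> sentence phi -> mul_formula phi ->
  models M phi -> models M' phi.
Proof.
move=> MT MT' phis phim Mphi e'.
pose N := level (fcode phi); pose k := N.+2`!.-2.
have ND s : 0 < s <= N -> s %| k.+2 by move=> sN; apply: dvdn_bigfact; lia.
apply/(to_unit_sat (MT := MT') (om := fun=> 0%R) e' (or_introl phim)).
apply/(sat_in_full (P := fun _ _ => True)) => //.
have FP := unit_filtration MT (fcode phi) ND.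
have FQ := unit_filtration MT' (fcode phi) ND.
apply: (proj1 (transfer (omG := fun=> 0%R) FP FQ _ _ (a := fun=> None) phis _ _ _ _)) => //.
- by move=> j _; exists 0%R; rewrite !mulr0z.
- split=> // m j _; rewrite /lin !big_ord0.
  by split=> /esym/unit_omega_ordz h; apply/esym/unit_omega_ordz.
- apply/(sat_in_full (P := fun _ _ => True)) => //.
  have := Mphi (fun=> zero_of M).
  rewrite (to_unit_sat (MT := MT) (om := fun=> 0%R) _ (or_introl phim)).
  rewrite (_ : to_unit MT \o _ = fun=> None) //.
  by apply: funext => i /=; rewrite to_unit0.
Qed.

(** * The complex numbers form a model *)

Section Complex.
Variable R : realType.
Local Open Scope ring_scope.
Local Open Scope complex_scope.

Definition cis (x : R) : R[i] := cos x +i* sin x.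

Lemma cisD x y : cis (x + y) = cis x * cis y.
Proof. by apply/eqP; rewrite /cis cosD sinD eq_complex /= eqxx /= addrC. Qed.

Lemma cisX x n : cis x ^+ n = cis (x *+ n).
Proof.
elim: n => [|n IH]; first by rewrite mulr0n /cis cos0 sin0.
by rewrite exprS IH -cisD mulrS.
Qed.

Lemma cis_neq1 x : 0 < x < 2 * pi -> cis x != 1.
Proof.
move=> /andP[x0 x2]; apply/eqP => -[c1 _].
have : 0 < sin (x / 2).
  by apply: sin_gt0_pi; rewrite divr_gt0 //= ltr_pdivrMr // mulrC.
have : cos (x / 2 *+ 2) = 1 by rewrite -[_ *+ 2]mulr_natr divfK ?pnatr_eq0.
rewrite cos_mulr2n => E s0; have := sin2cos2 (x / 2); have := mulr_gt0 s0 s0; lra.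
Qed.

Lemma croot_prim n : (0 < n)%N -> n.-primitive_root (croot R n).
Proof.
move=> n0; have nR : 0 < n%:R :> R by rewrite ltr0n.
rewrite /primitive_root_of_unity n0 /=; apply/forallP => i; apply/eqP.
rewrite unity_rootE cisX -[X in cis X]mulr_natr.
have [->|ne] := eqVneq i.+1 n.
  rewrite divfK ?lt0r_neq0 // /cis mulrC mulr_natr.
  by rewrite cos2pi sin2pi eqxx.
apply/negbTE/cis_neq1.
have iR : 0 < i.+1%:R :> R by rewrite ltr0n.
have ilt : i.+1%:R < n%:R :> R by rewrite ltr_nat ltn_neqAle ne ltn_ord.
have pi0 := pi_gt0 R.
rewrite mulrAC divr_gt0 ?mulr_gt0 //= ltr_pdivrMr //.
by rewrite ltr_pM2l ?mulr_gt0.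
Qed.

Lemma croot_dvd n d : (0 < n)%N -> (0 < d)%N -> croot R (n * d) ^+ d = croot R n.
Proof.
move=> n0 d0; rewrite cisX /croot -/(cis _); congr cis.
rewrite -[X in X = _]mulr_natr natrM; field.
by rewrite !pnatr_eq0 -!lt0n n0 d0.
Qed.

Lemma mpow_Cmul (x : Cmul R) n : mpow x n = (x : R[i]) ^+ n.
Proof. by []. Qed.

Lemma Cmul_model : mul_model (Cmul R).
Proof.
move=> phi [].
- by move=> e x y z /=; rewrite mulrA.
- by move=> e x /=; rewrite mulr1.
- by move=> e x /= x0; rewrite mulfV //; apply/eqP.
- by move=> e x y /=; rewrite mulrC.
- by apply/models_All => e x; apply/sat_And => /=; rewrite mulr0 invr0.
- move=> k; apply/models_M6 => i j ij; rewrite !mpow_Cmul => /eqP.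
  rewrite (eq_prim_root_expr (croot_prim _)) // !modn_small; lia.
- move=> k; apply/models_M7 => x; rewrite mpow_Cmul; split.
    move=> /(prim_rootP (croot_prim (isT : (0 < k.+2)%N)))[i ->].
    by exists i.
  move=> [i _ ->]; rewrite mpow_Cmul exprAC (prim_expr_order (croot_prim _)) //.
  by rewrite expr1n.
- move=> k; apply/models_M8 => x; exists (k.+2.-root (x : R[i])).
  by rewrite mpow_Cmul rootCK.
Qed.

End Complex.

Theorem mul_axiomatization (R : realType) : axiomatizes_mul_theory mul_axiom (Cmul R).
Proof.
move=> phi phis phim; split=> [Cphi|].
  apply: completeness => // [psi|M MT]; first exact: mul_axiom_sentence.
  exact: mul_elementary (@Cmul_model R) MT phis phim Cphi.
exact/soundness_theory/Cmul_model.
Qed.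

(** * Quantifier elimination *)

(** By induction on the list: whether or not alpha holds, Q is equivalent to
    a predicate that depends on the remaining formulas only. *)
Lemma qf_definable (M : structure) (L : seq formula) (Q : (nat -> M) -> Prop) :
  all quantifier_free L ->
  (forall e e', (forall alpha, alpha \in L -> sat e alpha <-> sat e' alpha) -> Q e -> Q e') ->
  exists2 psi, quantifier_free psi & forall e, Q e <-> sat e psi.
Proof.
elim: L Q => [|alpha L IH] Q /=.
  move=> _ Qinv; have [[e Qe]|nQ] := pselect (exists e, Q e).
    by exists Top => // e'; split=> [_|_] //; apply: (Qinv e).
  by exists Bot => // e; split=> // Qe; apply: nQ; exists e.
move=> /andP[qfa qfL] Qinv.
pose eqL e e' := forall beta, beta \in L -> sat (M := M) e beta <-> sat (M := M) e' beta.
have part (S : (nat -> M) -> Prop) : exists2 psi, quantifier_free psi &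
    forall e, (exists e', [/\ S e', eqL e e' & Q e']) <-> sat e psi.
  apply: IH => // e e' ee' [f [Sf ef Qf]]; exists f; split=> // beta bL.
  by rewrite -(ef beta bL) (ee' beta bL).
have [psi1 qf1 E1] := part (fun e => sat e alpha).
have [psi0 qf0 E0] := part (fun e => ~ sat e alpha).
exists (And (Imp alpha psi1) (Imp (Not alpha) psi0)); first by rewrite /= qfa qf1 qf0.
move=> e; rewrite sat_And.
have eqe : eqL e e by [].
split=> [Qe|[h1 h0]].
  split=> [ae|nae]; first by apply/E1; exists e.
  by apply/E0; exists e.
have [/[dup] ae /h1/E1[f [fa ef Qf]]|/[dup] nae /h0/E0[f [fa ef Qf]]] := pselect (sat e alpha).
  apply: (Qinv f) => // beta; rewrite inE => /orP[/eqP-> //|/ef]; by tauto.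
apply: (Qinv f) => // beta; rewrite inE => /orP[/eqP->|/ef]; by tauto.
Qed.

Definition zpow (t : term) (m : int) : term :=
  match m with Posz p => tpow t p | Negz p => tpow (Inv t) p.+1 end.

(** Variables with exponent 0 contribute the factor 1, even where their value
    is zero. *)
Definition monomial (n : nat) (m : nat -> int) : term :=
  foldr (fun i t => Mul (zpow (Var i) (m i)) t) One (iota 0 n).

Section WithZero.
Variables (G : zmodType) (om : nat -> G).
Local Open Scope ring_scope.

Lemma mpow_with_zero (u : G) n : mpow (M := with_zero om) (Some u) n = Some (u *+ n).
Proof.
case: n => // n; rewrite /mpow iteropS; elim: n => [|n IH]; first by rewrite mulr1n.
by rewrite iterS IH [u *+ n.+2]mulrS.
Qed.

Lemma eval_monomial n m (a : nat -> with_zero om) :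
  (forall i, (i < n)%N -> a i = None -> m i = 0) ->
  eval a (monomial n m) = Some (lin n m (fun i => unit_part (a i))).
Proof.
move=> am; rewrite /lin -(big_mkord predT (fun i => unit_part (a i) *~ m i)) /index_iota subn0.
have {am} : forall i, i \in iota 0 n -> a i = None -> m i = 0.
  by move=> i; rewrite mem_iota => /am.
rewrite /monomial; elim: (iota 0 n) => [|i s IH] am; first by rewrite big_nil.
rewrite big_cons /= IH; last by move=> l ls; apply: am; rewrite inE ls orbT.
have := am i (mem_head _ _); case: (m i) => p.
  rewrite [zpow _ _]/= eval_tpow /=; case Ei: (a i) => [u|] h; first by rewrite mpow_with_zero.
  by have [->] := h erefl; rewrite /= mul0rz.
rewrite -[zpow _ _]/(tpow (Inv (Var i)) p.+1) eval_tpow [eval _ _]/=.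
case Ei: (a i) => [u|] h; last by have := h erefl.
by rewrite [omap _ _]/= mpow_with_zero mulNrn.
Qed.

End WithZero.

Section QE.
Variable R : realType.
Local Open Scope ring_scope.
Let MT := @Cmul_model R.
Let log : R[i] -> option (unit_group_of MT) := to_unit MT.

Lemma unit_omega_dvd k l : (l.+2 %| k.+2)%N ->
  unit_omega MT l = unit_omega MT k *~ (k.+2 %/ l.+2)%N.
Proof.
move=> lk; apply: unit_inj; rewrite -pmulrn sval_mulrn mpow_Cmul /=.
have d0 : (0 < k.+2 %/ l.+2)%N by rewrite divn_gt0 // dvdn_leq.
by rewrite -[X in croot R X ^+ _](divnK lk) mulnC croot_dvd.
Qed.

(** Finite functions encode the vectors with entries in [-N, N], so that these
    can be enumerated. *)
Definition box_exponent n N (f : {ffun 'I_n -> 'I_(N + N).+1}) (i : nat) : int :=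
  if insub i is Some l then (f l)%:Z - N%:Z else 0.

Definition type_atoms (n N k : nat) : seq formula :=
  [seq Eq (Var i) Zero | i <- iota 0 n] ++
  [seq Eq (monomial n (box_exponent f)) (tpow (Omega k) j)
     | f <- enum {: {ffun 'I_n -> 'I_(N + N).+1}}, j <- iota 0 k.+2].

Lemma type_atoms_qf n N k : all quantifier_free (type_atoms n N k).
Proof.
apply/allP => phi; rewrite mem_cat.
by case/orP=> [/mapP[i _ ->]|/allpairsPdep[f [j [_ _ ->]]]]; apply: isT.
Qed.

(** An exponent vector may be set to 0 at the variables whose value is zero
    without changing its relation; then the monomial is invertible and the
    relation is an equation between terms. *)
Lemma same_type_of_atoms n N k (e e' : nat -> Cmul R) :
  (forall alpha, alpha \in type_atoms n N k -> sat e alpha <-> sat e' alpha) ->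
  same_type (unit_omega MT k) (unit_omega MT k) n N (log \o e) (log \o e').
Proof.
move=> ee'.
have zero_iff i : (i < n)%N -> e i = 0 <-> e' i = 0.
  move=> ni; apply: (ee' (Eq (Var i) Zero)); rewrite mem_cat map_f //.
  by rewrite mem_iota.
have logE (x : R[i]) : isSome (log x) = (x != 0).
  by rewrite /log; case: to_unitP => [->|u ->] /=; rewrite ?eqxx //; apply/esym/eqP/(svalP u).
split=> [i ni|m j mN].
  by rewrite /= !logE; congr negb; apply/eqP/eqP => /zero_iff; apply.
have zD : unit_omega MT k *+ k.+2 = 0 by apply/unit_omega_ord.
rewrite !(mulz_mod j (ltn0Sn k.+1) zD); set j' := `|_|%N.
have j'k : (j' < k.+2)%N by apply: ltn_modz.
pose m' i := if e i == 0 then 0 else m i.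
have lin_m' (f : nat -> R[i]) : (forall i, (i < n)%N -> e i = 0 <-> f i = 0) ->
    lin n m (fun i => unit_part (log (f i))) = lin n m' (fun i => unit_part (log (f i))).
  move=> ef; apply: eq_bigr => i _; rewrite /m'; case: eqP => // ei.
  rewrite (proj1 (ef i (ltn_ord i)) ei).
  by rewrite /log to_unit0 mul0rz.
rewrite !lin_m' //.
pose F := [ffun l : 'I_n => inord `|(m' l + N%:Z)%R|%N : 'I_(N + N).+1].
pose mF := box_exponent F.
have mFE i : (i < n)%N -> mF i = m' i.
  move=> ni; rewrite /mF /box_exponent insubT /= ffunE inordK /=;
    by have := mN i ni; rewrite /m'; case: ifP; lia.
have linF (f : nat -> unit_group_of MT) : lin n m' f = lin n mF f.
  by apply: eq_bigr => i _; rewrite mFE.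
pose alpha := Eq (monomial n mF) (tpow (Omega k) j').
have satE (f : nat -> R[i]) : (forall i, (i < n)%N -> e i = 0 <-> f i = 0) ->
    sat (M := Cmul R) f alpha <-> lin n mF (fun i => unit_part (log (f i))) = unit_omega MT k *+ j'.
  move=> ef; have om := to_unit_omega MT.
  have E : log (eval (M := Cmul R) f (monomial n mF)) =
      Some (lin n mF (fun i => unit_part (log (f i)))).
    rewrite /log (to_unit_eval (om := unit_omega MT)); last by right.
    rewrite eval_monomial // => i ni; rewrite mFE // /m' => fi.
    have : isSome (log (f i)) = false by rewrite /log -[to_unit _ _]/((to_unit MT \o f) i) fi.
    by rewrite logE; case: eqP => // /(ef i ni) ->; rewrite eqxx.
  have E' : log (eval (M := Cmul R) f (tpow (Omega k) j')) = Some (unit_omega MT k *+ j').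
    rewrite eval_tpow -[eval _ _]/(sval (unit_omega MT k)) -sval_mulrn.
    exact: to_unit_sval.
  split=> [h|h]; last by apply: (@to_unit_inj _ MT); rewrite -/log E E' h.
  by move: E; rewrite [eval _ _]h E' => -[].
rewrite !linF -!satE //; apply: ee'; rewrite mem_cat; apply/orP; right.
apply/allpairsPdep; exists F, j'; split=> //; first by rewrite mem_enum.
by rewrite mem_iota.
Qed.

Theorem Cmul_quantifier_elimination : quantifier_elimination (Cmul R).
Proof.
move=> phi; pose C := fcode phi; pose N := level C.
pose k := N.+2`!.-2; pose n := formula_bound phi.
apply: (qf_definable (type_atoms_qf n N k)) => e e' /same_type_of_atoms ee'.
have ND s : (0 < s <= N)%N -> (s %| k.+2)%N by move=> sN; apply: dvdn_bigfact; lia.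
have F := unit_filtration MT C ND.
have om_z l : (l <= C)%N -> exists j : int,
    unit_omega MT l = unit_omega MT k *~ j /\ unit_omega MT l = unit_omega MT k *~ j.
  move=> lC; exists (k.+2 %/ l.+2)%N; suff /unit_omega_dvd : (l.+2 %| k.+2)%N by [].
  by apply: dvdn_bigfact; have := leq_level C; rewrite -/N; lia.
have := transfer F F om_z (leqnn N) (formula_below_bound phi) (leqnn _)
  (fun _ _ => I) (fun _ _ => I) ee'.
rewrite !sat_in_full // => T.
rewrite !(to_unit_sat (om := unit_omega MT)); try by right; apply: to_unit_omega.
by move/T.
Qed.
End QE.

(** * Bounded evaluation in a finite cyclic group *)

Section BoundedEvaluation.
Variables (b D : nat).

(** A number x < D stands for the x-th power of a primitive D-th root of
    unity, and D stands for zero. *)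
Fixpoint term_value (e : nat -> nat) (t : term) : nat :=
  match t with
  | Var i => e i
  | Mul t u =>
      let x := term_value e t in let y := term_value e u in
      if (x == D) || (y == D) then D else (x + y) %% D
  | Inv t => let x := term_value e t in if x == D then D else (D - x) %% D
  | Zero => D
  | One => 0
  | Omega k => D %/ k.+2
  end.

Fixpoint formula_value (e : nat -> nat) (phi : formula) : bool :=
  match phi with
  | Eq t u => term_value e t == term_value e u
  | Bot => false
  | Imp phi psi => formula_value e phi ==> formula_value e psi
  | All psi => [forall x : 'I_D.+1,
      (b ^ fcode (All psi) %| x) ==> formula_value (scons (x : nat) e) psi]
  end.

Lemma formula_value_All e psi :
  formula_value e (All psi) = [forall x : 'I_D.+1,
      (b ^ fcode (All psi) %| x) ==> formula_value (scons (x : nat) e) psi].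
Proof. by []. Qed.

End BoundedEvaluation.

Section Cyclic.
Variables (G : zmodType) (z : G) (b N C : nat).
Local Open Scope ring_scope.
Let D := (b ^ C.+2)%N.
Hypothesis b_gt : (N.+1 < b)%N.
Hypothesis b_dvd : forall s, (0 < s <= N)%N -> (s %| b)%N.
Hypothesis z_ord : forall j : int, z *~ j = 0 <-> (D %| `|j|)%N.
Hypothesis torsion : forall u : G, u *+ D = 0 -> exists j : int, u = z *~ j.

(** The powers of z whose order divides [b ^ (C + 2 - c)]. *)
Definition cyclic_layer (c : nat) (u : G) : Prop :=
  exists j : int, u = z *~ (j * (b ^ c)%N%:Z).

Lemma b_gt0 : (0 < b)%N. Proof. by lia. Qed.
Lemma D_gt1 : (1 < D)%N.
Proof. by rewrite /D -[1%N](expn0 b) ltn_exp2l //; lia. Qed.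

Lemma z_eq (i j : int) : z *~ i = z *~ j <-> (D%:Z %| i - j)%Z.
Proof.
rewrite dvdzE /= -z_ord mulrzBr; split=> [->|/eqP]; first by rewrite subrr.
by rewrite subr_eq0 => /eqP.
Qed.

Lemma expb_dvd c c' : (c <= c')%N -> ((b ^ c)%N%:Z %| (b ^ c')%N%:Z)%Z.
Proof. by move=> cc; rewrite dvdzE /= dvdn_exp2l. Qed.

Lemma cyclic_layerP c (j : int) : (c <= C.+2)%N ->
  cyclic_layer c (z *~ j) <-> ((b ^ c)%N%:Z %| j)%Z.
Proof.
move=> cC; split=> [[l /z_eq /(dvdz_trans (expb_dvd cC)) h]|/dvdzP[l ->]]; last by exists l.
by rewrite -(subrK (l * (b ^ c)%N%:Z) j) rpredD // dvdz_mull.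
Qed.

Lemma cyclic_layerB c u v : cyclic_layer c u -> cyclic_layer c v -> cyclic_layer c (u - v).
Proof. by move=> [i ->] [j ->]; exists (i - j); rewrite -mulrzBr mulrBl. Qed.

Lemma cyclic_layer_lin c n m (a : nat -> G) :
  (forall i, (i < n)%N -> cyclic_layer c (a i)) -> cyclic_layer c (lin n m a).
Proof.
have P0 : cyclic_layer c 0 by exists 0; rewrite mul0r.
move=> Pa; rewrite /lin; elim/big_ind: _ => [//|u v Pu Pv|i _].
  by rewrite -[v]opprK; apply: cyclic_layerB => //; rewrite -sub0r; apply: cyclic_layerB.
by have [l ->] := Pa i (ltn_ord i); exists (l * m i); rewrite -mulrzA; congr (_ *~ _); ring.
Qed.

(** Elements of layer c + 1 have s-th roots in layer c since s divides b.  The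
    generator [z^(b^c)] of layer c is independent of layer c + 1 because its
    order modulo that layer is b, which exceeds the bound on exponents. *)
Lemma cyclic_filtration : filtration (z *~ (b ^ C.+1)%N) N C cyclic_layer.
Proof.
split.
- exists b => // u ub; have [|j uj] := torsion (u := u).
    by rewrite /D expnS mulrnA ub mul0rn.
  move: ub; rewrite uj pmulrn -mulrzA z_ord abszM /= /D [X in (X %| _)%N]expnSr.
  rewrite dvdn_pmul2r ?b_gt0 // => /dvdnP[q jq].
  have /dvdzP[l ->] : ((b ^ C.+1)%N%:Z %| j)%Z by rewrite dvdzE /= jq dvdn_mull.
  by exists l; rewrite -mulrzA mulrC.
- move=> c cC; apply/cyclic_layerP; first by lia.
  exact: expb_dvd.
- exact: cyclic_layerB.
- move=> c u [i ->]; exists (i * b); congr (_ *~ _).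
  by rewrite expnS PoszM mulrA.
- move=> c s u cC sN [i ->]; have /dvdnP[q bq] := b_dvd sN.
  exists (z *~ (i * q%:Z * (b ^ c)%N%:Z)); first by exists (i * q%:Z).
  rewrite pmulrn -mulrzA; congr (_ *~ _).
  by rewrite (_ : b ^ c.+1 = q * s * b ^ c)%N; [rewrite !PoszM; ring | rewrite -bq expnS].
- move=> c n k a cC kN Pa; exists (z *~ (b ^ c)%N); first by exists 1; rewrite mul1r.
  move=> s m j sk mk E.
  have P_z (i : int) : cyclic_layer c.+1 (z *~ (b ^ C.+1)%N *~ i).
    rewrite -mulrzA; apply/cyclic_layerP; first by lia.
    by rewrite dvdz_mulr // expb_dvd.
  have : cyclic_layer c.+1 (z *~ ((b ^ c)%N * s)%N).
    have -> : z *~ ((b ^ c)%N * s)%N = z *~ (b ^ C.+1)%N *~ j - lin n m a.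
      by rewrite -E PoszM mulrzA addrAC subrr add0r.
    exact: cyclic_layerB (P_z j) (cyclic_layer_lin _ Pa).
  move/cyclic_layerP => /(_ (ltac:(lia) : (c.+1 <= C.+2)%N)).
  rewrite dvdzE /= expnSr dvdn_pmul2l ?expn_gt0 ?b_gt0 // => /dvdn_leq; lia.
Qed.

Definition cyclic_omega (k : nat) : G := z *+ (D %/ k.+2).

Definition decode_elt (x : nat) : option G := if x == D then None else Some (z *+ x).

Lemma z_mod x : z *+ (x %% D) = z *+ x.
Proof.
have zD : z *+ D = 0 by rewrite pmulrn; apply/z_ord.
by rewrite {2}(divn_eq x D) mulrnDr mulnC mulrnA zD mul0rn add0r.
Qed.

Lemma decode_elt_mod x : decode_elt (x %% D) = Some (z *+ x).
Proof.
rewrite /decode_elt ifN_eq; first by rewrite z_mod.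
by rewrite ltn_eqF // ltn_mod; have := D_gt1; lia.
Qed.

Lemma decode_elt_inj x y : (x <= D)%N -> (y <= D)%N -> decode_elt x = decode_elt y -> x = y.
Proof.
have lt_D u : (u <= D)%N -> (u == D) = false -> (u < D)%N by lia.
rewrite /decode_elt => xD yD; case: eqP => [->|/eqP/negbTE/lt_D xltD];
  case: eqP => [->|/eqP/negbTE/lt_D yltD] // [].
rewrite !pmulrn => /z_eq h; have := xltD xD; have := yltD yD => y1 x1.
move: h; rewrite dvdzE /= => /dvdn_leq; lia.
Qed.

Lemma term_value_leq e t : (forall i, (e i <= D)%N) -> (term_value D e t <= D)%N.
Proof.
move=> eD; have modD x : (x %% D <= D)%N by rewrite ltnW // ltn_mod; have := D_gt1; lia.
elim: t => //= [t _ u _|t _|k]; try by case: ifP.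
exact: leq_div.
Qed.

Lemma term_valueP e t : (forall i, (e i <= D)%N) ->
  decode_elt (term_value D e t) = eval (M := with_zero cyclic_omega) (decode_elt \o e) t.
Proof.
move=> eD; elim: t => //= [t <- u <-|t <-|||k].
- rewrite {2 3}/decode_elt; case: eqP => [|_] /=; first by rewrite /decode_elt eqxx.
  case: eqP => [|_] /=; first by rewrite /decode_elt eqxx.
  by rewrite decode_elt_mod mulrnDr.
- rewrite {2}/decode_elt; have := term_value_leq t eD.
  case: eqP => [|_] tD /=; first by rewrite /decode_elt eqxx.
  rewrite decode_elt_mod mulrnBr //.
  have -> : z *+ D = 0 by rewrite pmulrn; apply/z_ord.
  by rewrite sub0r.
- by rewrite /decode_elt eqxx.
- by rewrite -(decode_elt_mod 0) mod0n.
- rewrite -decode_elt_mod modn_small // ltn_Pdiv //; have := D_gt1; lia.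
Qed.

Lemma formula_valueP phi e : (forall i, (e i <= D)%N) -> (fcode phi <= C)%N ->
  sat_in (M := with_zero cyclic_omega) (fun c x => cyclic_layer c (unit_part x))
    (decode_elt \o e) phi <->
  formula_value b D e phi.
Proof.
elim: phi e => [t u||phi IH psi IH'|phi IH] e eD phiC.
- rewrite /= -!term_valueP //; split=> [/decode_elt_inj -> //|/eqP-> //]; exact: term_value_leq.
- by [].
- have : (fcode phi + fcode psi < fcode (Imp phi psi))%N := code_cons3_gt 2 _ _.
  by move=> h; rewrite /= IH ?IH' //; lia.
have phi_lt : (fcode phi < fcode (All phi))%N by exact: code_cons2_gt.
have E x : scons (decode_elt x) (decode_elt \o e) = decode_elt \o scons x e.
  by apply: funext => -[].
have sconsD x : (x <= D)%N -> forall i, (scons x e i <= D)%N by move=> xD -[|i] /=.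
rewrite formula_value_All /sat_in -/(sat_in _).
move: phiC phi_lt; set c := fcode (All phi) => cC phi_lt.
have layerE x : (x <= D)%N -> cyclic_layer c (unit_part (decode_elt x)) <-> (b ^ c %| x)%N.
  move=> xD; rewrite /decode_elt; case: eqP => [->|_] /=.
    split=> _; last by exists 0; rewrite mul0r.
    by rewrite dvdn_exp2l //; lia.
  by rewrite pmulrn cyclic_layerP ?dvdzE //; lia.
split=> [h|/forallP h x xc].
  apply/forallP => x; apply/implyP => xc; apply/IH; try lia.
    by apply: sconsD; rewrite -ltnS.
  by rewrite -E; apply: h; apply/layerE => //; rewrite -ltnS.
have [y yD xy] : exists2 y, (y <= D)%N & x = decode_elt y.
  case: x xc => [u|] xc; last by exists D => //; rewrite /decode_elt eqxx.
  case: xc => j uj; have D0 : (0 < D)%N by have := D_gt1; lia.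
  exists (`|((j * (b ^ c)%N) %% D)%Z| %% D)%N; first by rewrite ltnW // ltn_mod.
  have zD : z *+ D = 0 by rewrite pmulrn; apply/z_ord.
  by rewrite decode_elt_mod -(mulz_mod _ D0 zD) -uj.
have := h (Ordinal (yD : (y < D.+1)%N)) => /implyP /=; rewrite xy E => hy.
apply/IH; [exact: sconsD|lia|apply: hy].
by apply/layerE; rewrite // -xy.
Qed.

End Cyclic.

Section Decision.
Variable R : realType.
Local Open Scope ring_scope.
Let MT := @Cmul_model R.

(** The factorial makes the base divisible by all numbers up to the level, so
    that it provides all roots of unity that the sentence can speak of. *)
Definition truth_base (c : nat) : nat := (level c).+2`!.
Definition truth_modulus (c : nat) : nat := (truth_base c ^ c.+2)%N.

Lemma models_formula_value phi : sentence phi ->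
  models (Cmul R) phi <->
  formula_value (truth_base (fcode phi)) (truth_modulus (fcode phi)) (fun=> 0%N) phi.
Proof.
move=> phis; set C := fcode phi; set b := truth_base C; set D := truth_modulus C.
pose N := level C.
have b_gt : (N.+1 < b)%N by apply: fact_geq.
have [k0 bE] : exists k0, b = k0.+2 by exists b.-2; lia.
have D_gt : (1 < D)%N by rewrite /D /truth_modulus -/b -[1%N](expn0 b) ltn_exp2l //; lia.
have [k DE] : exists k, D = k.+2 by exists D.-2; lia.
have b_dvd s : (0 < s <= N.+2)%N -> (s %| b)%N by move=> sN; apply: dvdn_fact.
pose z := unit_omega MT k.
have bD : (b %| D)%N by rewrite /D /truth_modulus -/b expnS dvdn_mulr.
have omE k' l m : m = k'.+2 -> (l.+2 %| m)%N ->
    unit_omega MT l = unit_omega MT k' *~ (m %/ l.+2)%N.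
  by move=> ->; apply: unit_omega_dvd.
have zb : unit_omega MT k0 = z *~ (b ^ C.+1)%N.
  rewrite (omE k _ _ DE) -?bE //; congr (_ *~ _).
  by rewrite /D /truth_modulus -/b expnS mulKn //; lia.
have ND s : (0 < s <= N)%N -> (s %| k0.+2)%N by rewrite -bE => sN; apply: b_dvd; lia.
have F := unit_filtration MT C ND.
have z_ord (j : int) : z *~ j = 0 <-> (D %| `|j|)%N by rewrite DE; apply: unit_omega_ordz.
have b_dvd' s : (0 < s <= N)%N -> (s %| b)%N by rewrite bE; apply: ND.
have tor (u : unit_group_of MT) : u *+ D = 0 -> exists j : int, u = z *~ j.
  by rewrite DE => /unit_torsion[i _ ->]; exists i.
have F' := cyclic_filtration b_gt b_dvd' z_ord tor; rewrite -zb in F'.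
have om_z l : (l <= C)%N -> exists j : int,
    unit_omega MT l = unit_omega MT k0 *~ j /\ cyclic_omega z b C l = unit_omega MT k0 *~ j.
  move=> lC; have lb : (l.+2 %| b)%N by apply: b_dvd; have := leq_level C; rewrite -/N; lia.
  exists (b %/ l.+2)%N; rewrite -(omE _ _ _ bE lb); split=> //.
  rewrite /cyclic_omega -/D pmulrn (omE k l _ DE) //.
  exact: dvdn_trans lb bD.
pose e0 : nat -> option (unit_group_of MT) := decode_elt z b C \o (fun=> 0%N).
have agree0 : same_type (unit_omega MT k0) (unit_omega MT k0) 0 N
    (fun=> None : option (unit_group_of MT)) e0.
  by split=> // m j _; rewrite /lin !big_ord0.
have := transfer F F' om_z (leqnn N) phis (leqnn _) _ _ agree0.
rewrite sat_in_full // (formula_valueP b_gt z_ord) // => T.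
have e0E : to_unit MT \o (fun _ : nat => 0) = (fun _ : nat => None).
  by apply: funext => i /=; rewrite to_unit0.
split=> [h|h e].
  apply/T => //; rewrite -e0E -to_unit_sat; first exact: h.
  by right; apply: to_unit_omega.
rewrite (eq_sat_below (M := Cmul R) (f := fun _ : nat => 0 : R[i]) phis) //.
rewrite (to_unit_sat (om := unit_omega MT)); last by right; apply: to_unit_omega.
by rewrite e0E; apply/T.
Qed.

End Decision.

(** * Recursive functions *)

(** Tuples are read by [nth], whose value at a numeral reduces when the tuple
    is consed, as in the equations for primitive recursion. *)
Definition rec1 (f : nat -> nat) : Prop :=
  @recursive 1 (fun v => f (nth 0 v 0)).
Definition rec2 (f : nat -> nat -> nat) : Prop :=
  @recursive 2 (fun v => f (nth 0 v 0) (nth 0 v 1)).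
Definition rec3 (f : nat -> nat -> nat -> nat) : Prop :=
  @recursive 3 (fun v => f (nth 0 v 0) (nth 0 v 1) (nth 0 v 2)).

Lemma recursive_ext k (f g : k.-tuple nat -> nat) : f =1 g -> recursive f -> recursive g.
Proof. by move=> /funext ->. Qed.

Lemma recursive_nth k i : i < k -> @recursive k (fun v => nth 0 v i).
Proof.
move=> ik; apply: recursive_ext (RecProj (Ordinal ik)) => v.
by rewrite (tnth_nth 0).
Qed.

Lemma nth_mktuple_ord n (F : 'I_n -> nat) i (ni : i < n) :
  nth 0 [tuple F j | j < n] i = F (Ordinal ni).
Proof. by rewrite -[i in LHS]/(val (Ordinal ni)) -tnth_nth tnth_mktuple. Qed.

Section Composition.
Variable k : nat.
Implicit Types a b : k.-tuple nat -> nat.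

Lemma recursive_comp1 f a : rec1 f -> recursive a -> recursive (fun v => f (a v)).
Proof.
move=> rf ra; apply: recursive_ext (RecComp rf (h := fun=> a) (fun=> ra)) => v.
by rewrite nth_mktuple_ord.
Qed.

Lemma recursive_comp2 f a b : rec2 f -> recursive a -> recursive b ->
  recursive (fun v => f (a v) (b v)).
Proof.
move=> rf ra rb; pose h (i : 'I_2) := if val i is 0 then a else b.
have rh i : recursive (h i) by rewrite /h; case: (val i).
apply: recursive_ext (RecComp rf rh) => v.
by rewrite !nth_mktuple_ord.
Qed.

Lemma recursive_const n : @recursive k (fun=> n).
Proof.
elim: n => [|n IH]; first exact: RecZero.
by apply: (recursive_comp1 (f := S)) IH; apply: recursive_ext RecSucc => v; rewrite /thead (tnth_nth 0).
Qed.

End Composition.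

Lemma rec2_prim g h : rec1 g -> rec3 h ->
  rec2 (fun n y => nat_rect (fun=> nat) (g y) (fun m acc => h m acc y) n).
Proof. by move=> rg rh; apply: RecPrim rg rh _ _. Qed.

Lemma rec1_S : rec1 S.
Proof. by apply: recursive_ext RecSucc => v; rewrite /thead (tnth_nth 0). Qed.

Lemma rec2_swap f : rec2 f -> rec2 (fun x y => f y x).
Proof. by move=> rf; apply: recursive_comp2 rf _ _; apply: recursive_nth. Qed.

Lemma rec1_comp2 f a b : rec2 f -> rec1 a -> rec1 b -> rec1 (fun x => f (a x) (b x)).
Proof. exact: recursive_comp2. Qed.

Lemma rec1_comp f a : rec1 f -> rec1 a -> rec1 (fun x => f (a x)).
Proof. exact: recursive_comp1. Qed.

Lemma rec1_id : rec1 id. Proof. exact: recursive_nth. Qed.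
Lemma rec1_const n : rec1 (fun=> n). Proof. exact: recursive_const. Qed.

Lemma rec1_ext f g : f =1 g -> rec1 f -> rec1 g.
Proof. by move=> fg; apply: recursive_ext => v. Qed.

Lemma rec2_ext f g : f =2 g -> rec2 f -> rec2 g.
Proof. by move=> fg; apply: recursive_ext => v. Qed.

Lemma rec2_addn : rec2 addn.
Proof.
apply: rec2_ext (rec2_prim rec1_id (h := fun m acc y => acc.+1) _).
  by elim=> //= n IH y; rewrite IH addSn.
by apply: recursive_comp1 rec1_S _; apply: recursive_nth.
Qed.

Lemma rec2_muln : rec2 muln.
Proof.
apply: rec2_ext (rec2_prim (rec1_const 0) (h := fun m acc y => y + acc) _).
  by elim=> //= n IH y; rewrite IH mulSn.
by apply: recursive_comp2 rec2_addn _ _; apply: recursive_nth.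
Qed.

Lemma rec1_predn : rec1 predn.
Proof.
have r : rec2 (fun n _ => n.-1).
  apply: rec2_ext (rec2_prim (rec1_const 0) (h := fun m acc y => m) _).
    by case.
  exact: recursive_nth.
exact: rec1_comp2 r rec1_id rec1_id.
Qed.

Lemma rec2_subn : rec2 subn.
Proof.
apply: (rec2_swap (f := fun n y => y - n)).
apply: (rec2_ext (f := fun n y => nat_rect (fun=> nat) y (fun _ acc => acc.-1) n)).
  by elim=> [|n IH] y; rewrite ?subn0 // subnS -IH.
apply: (rec2_prim rec1_id (h := fun m acc y => acc.-1)).
by apply: recursive_comp1 rec1_predn _; apply: recursive_nth.
Qed.

Lemma rec2_expn : rec2 expn.
Proof.
apply: (rec2_swap (f := fun n y => y ^ n)).
apply: (rec2_ext (f := fun n y => nat_rect (fun=> nat) 1 (fun _ acc => y * acc) n)).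
  by elim=> [|n IH] y //; rewrite expnS -IH.
apply: (rec2_prim (rec1_const 1) (h := fun m acc y => y * acc)).
by apply: recursive_comp2 rec2_muln _ _; apply: recursive_nth.
Qed.

Lemma rec1_eq0 : rec1 (fun n => n == 0).
Proof.
apply: (recursive_ext (f := fun v : 1.-tuple nat => 1 - nth 0 v 0)).
  by move=> v; case: (nth 0 v 0) => [|[]].
exact: rec1_comp2 rec2_subn (rec1_const 1) rec1_id.
Qed.

Lemma rec2_eqn : rec2 (fun x y => x == y).
Proof.
apply: (rec2_ext (f := fun x y => (x - y) + (y - x) == 0)).
  by move=> x y; congr nat_of_bool; lia.
apply: recursive_comp1 rec1_eq0 _; apply: recursive_comp2 rec2_addn rec2_subn _.
exact: rec2_swap rec2_subn.
Qed.

Lemma modnS_eq n d : n.+1 %% d = (n %% d).+1 * (nat_of_bool ((n %% d).+1 == d) == 0).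
Proof.
case: d => [|d]; first by rewrite !modn0 muln1.
rewrite modnS; suff -> : (d.+1 %| n.+1) = ((n %% d.+1).+1 == d.+1).
  by case: eqP => _; rewrite ?muln0 ?muln1.
have nd : n %% d.+1 < d.+1 by rewrite ltn_mod.
rewrite {1}(divn_eq n d.+1) -addnS dvdn_addr ?dvdn_mull //.
by apply/idP/eqP => [/dvdn_leq|->//]; lia.
Qed.

Lemma rec2_modn : rec2 modn.
Proof.
apply: rec2_ext (rec2_prim (rec1_const 0)
  (h := fun _ acc d => acc.+1 * (nat_of_bool (acc.+1 == d) == 0)) _).
  by move=> + d; elim=> [|n IH]; rewrite ?mod0n // modnS_eq -IH.
have r : @recursive 3 (fun v => (nth 0 v 1).+1).
  by apply: recursive_comp1 rec1_S _; apply: recursive_nth.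
apply: recursive_comp2 rec2_muln (r) _; apply: recursive_comp1 rec1_eq0 _.
apply: recursive_comp2 rec2_eqn (r) _.
exact: recursive_nth.
Qed.

Lemma rec2_dvdn : rec2 (fun d n => d %| n).
Proof.
by apply: recursive_comp1 rec1_eq0 _; apply: rec2_swap rec2_modn.
Qed.

Lemma rec2_divn : rec2 divn.
Proof.
apply: rec2_ext (rec2_prim (rec1_const 0) (h := fun m acc d => (d %| m.+1) + acc) _).
  move=> + d; elim=> [|n IH] /=; first by rewrite div0n.
  by rewrite IH; case: d {IH} => [|d]; rewrite ?divn0 // divnS.
apply: recursive_comp2 rec2_addn _ _; last exact: recursive_nth.
apply: recursive_comp2 rec2_dvdn _ _; first exact: recursive_nth.
by apply: recursive_comp1 rec1_S _; apply: recursive_nth.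
Qed.

(** The list constructor on the codes of [CodeSeq].  It also serves as the
    pairing function by which functions of several variables become unary: a
    context of variables is coded as a list. *)
Definition cons_code (x y : nat) : nat := 2 ^ x * y.*2.+1.
Definition head_code (n : nat) : nat := \sum_(h < n) (2 ^ h.+1 %| n).
Definition tail_code (n : nat) : nat := n %/ 2 ^ head_code n %/ 2.

Lemma head_cons x y : head_code (cons_code x y) = x.
Proof.
have lt_x : x < cons_code x y by apply: leq_trans (ltn_expl x (isT : 1 < 2)) (leq_pmulr _ _).
rewrite /head_code; under eq_bigr => h _.
  rewrite pfactor_dvdn //; last by lia.
  rewrite /cons_code lognM ?expn_gt0 // pfactorK // (lognE 2) dvdn2 /= odd_double addn0.
  over.
rewrite -(big_mkord predT (fun h => nat_of_bool (h < x))).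
rewrite (big_cat_nat (n := x)) //=; last exact: ltnW.
rewrite [X in X + _]big_nat [X in _ + X]big_nat.
rewrite (eq_bigr (fun=> 1)) => [|h /andP[_ ->]] //.
rewrite [X in _ + X]big1 => [|h /andP[xh _]]; last by rewrite ltnNge xh.
by rewrite -big_nat sum_nat_const_nat subn0 muln1 addn0.
Qed.

Lemma tail_cons x y : tail_code (cons_code x y) = y.
Proof.
by rewrite /tail_code head_cons /cons_code mulKn ?expn_gt0 // -addn1 -muln2 divnMDl // addn0.
Qed.

Lemma rec2_cons : rec2 cons_code.
Proof.
apply: (rec2_ext (f := fun x y => 2 ^ x * (y + y).+1)) => [x y|]; first by rewrite addnn.
apply: recursive_comp2 rec2_muln _ _.
  by apply: recursive_comp2 rec2_expn (recursive_const _ 2) _; apply: recursive_nth.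
by apply: recursive_comp1 rec1_S _; apply: recursive_comp2 rec2_addn _ _; apply: recursive_nth.
Qed.

Lemma rec1_head : rec1 head_code.
Proof.
have r : rec2 (fun m n => \sum_(h < m) (2 ^ h.+1 %| n)).
  apply: rec2_ext (rec2_prim (rec1_const 0) (h := fun h acc n => acc + (2 ^ h.+1 %| n)) _).
    by move=> + n; elim=> [|m IH]; rewrite ?big_ord0 // big_ord_recr -IH.
  apply: recursive_comp2 rec2_addn (recursive_nth _) _ => //.
  apply: recursive_comp2 rec2_dvdn _ (recursive_nth _) => //.
  apply: recursive_comp2 rec2_expn (recursive_const _ 2) _.
  by apply: recursive_comp1 rec1_S _; apply: recursive_nth.
exact: rec1_comp2 r rec1_id rec1_id.
Qed.

Lemma rec1_tail : rec1 tail_code.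
Proof.
apply: rec1_comp2 rec2_divn _ (rec1_const 2).
apply: rec1_comp2 rec2_divn rec1_id _.
exact: rec1_comp2 rec2_expn (rec1_const 2) rec1_head.
Qed.

(** In the step function the bound variables m and acc are the first two
    entries of the context. *)
Lemma rec1_prim (g n : nat -> nat) (h : nat -> nat -> nat -> nat) :
  rec1 g ->
  rec1 (fun w => h (head_code w) (head_code (tail_code w)) (tail_code (tail_code w))) ->
  rec1 n ->
  rec1 (fun c => nat_rect (fun=> nat) (g c) (fun m acc => h m acc c) (n c)).
Proof.
move=> rg rh rn.
pose f n y := nat_rect (fun=> nat) (g y) (fun m acc => h m acc y) n.
apply: (rec1_comp2 (f := f)) rn rec1_id; apply: rec2_prim => //.
pose h' w := h (head_code w) (head_code (tail_code w)) (tail_code (tail_code w)).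
apply: (recursive_ext (f := fun v : 3.-tuple nat =>
  h' (cons_code (nth 0 v 0) (cons_code (nth 0 v 1) (nth 0 v 2))))).
  by move=> v; rewrite /h' tail_cons head_cons tail_cons head_cons.
apply: recursive_comp1 rh _; apply: recursive_comp2 rec2_cons (recursive_nth _) _ => //.
by apply: recursive_comp2 rec2_cons (recursive_nth _) (recursive_nth _).
Qed.

Lemma rec1_sum (n : nat -> nat) (f : nat -> nat -> nat) :
  rec1 (fun w => f (head_code w) (tail_code w)) -> rec1 n ->
  rec1 (fun c => \sum_(x < n c) f x c).
Proof.
move=> rf rn.
apply: (rec1_ext (f := fun c =>
  nat_rect (fun=> nat) 0 (fun m acc => acc + f m c) (n c))).
  by move=> c; elim: (n _) => [|m IH]; rewrite ?big_ord0 // big_ord_recr -IH.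
apply: (rec1_prim (h := fun m acc c => acc + f m c)) (rec1_const 0) _ rn.
apply: rec1_comp2 rec2_addn _ _; first exact: rec1_comp rec1_head rec1_tail.
apply: (rec1_ext (f := fun c => (fun w => f (head_code w) (tail_code w))
   (cons_code (head_code c) (tail_code (tail_code c))))).
  by move=> v; rewrite head_cons tail_cons.
apply: (rec1_comp rf); apply: (rec1_comp2 rec2_cons rec1_head).
exact: rec1_comp rec1_tail rec1_tail.
Qed.

Lemma rec1_if (P : nat -> bool) a b : rec1 (fun c => P c) -> rec1 a -> rec1 b ->
  rec1 (fun c => if P c then a c else b c).
Proof.
move=> rP ra rb; apply: (rec1_ext (f := fun c => P c * a c + (1 - P c) * b c)).
  by move=> c; case: (P _); rewrite ?mul1n ?mul0n ?addn0.
apply: (rec1_comp2 rec2_addn); apply: (rec1_comp2 rec2_muln) => //.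
exact: rec1_comp2 rec2_subn (rec1_const 1) rP.
Qed.

Ltac rec_tac := lazymatch goal with
  | |- rec1 (fun c => c) => exact: rec1_id
  | |- rec1 S => exact: rec1_S
  | |- rec1 head_code => exact: rec1_head
  | |- rec1 tail_code => exact: rec1_tail
  | |- rec1 (fun c => head_code _) => apply: (rec1_comp rec1_head); rec_tac
  | |- rec1 (fun c => tail_code _) => apply: (rec1_comp rec1_tail); rec_tac
  | |- rec1 (fun c => cons_code _ _) => apply: (rec1_comp2 rec2_cons); rec_tac
  | |- rec1 (fun c => addn _ _) => apply: (rec1_comp2 rec2_addn); rec_tac
  | |- rec1 (fun c => muln _ _) => apply: (rec1_comp2 rec2_muln); rec_tac
  | |- rec1 (fun c => subn _ _) => apply: (rec1_comp2 rec2_subn); rec_tac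
  | |- rec1 (fun c => expn _ _) => apply: (rec1_comp2 rec2_expn); rec_tac
  | |- rec1 (fun c => modn _ _) => apply: (rec1_comp2 rec2_modn); rec_tac
  | |- rec1 (fun c => divn _ _) => apply: (rec1_comp2 rec2_divn); rec_tac
  | |- rec1 (fun c => predn _) => apply: (rec1_comp rec1_predn); rec_tac
  | |- rec1 (fun c => nat_of_bool (dvdn _ _)) => apply: (rec1_comp2 rec2_dvdn); rec_tac
  | |- rec1 (fun c => nat_of_bool (@eq_op _ _ _)) => apply: (rec1_comp2 rec2_eqn); rec_tac
  | |- rec1 (fun c => if _ then _ else _) => apply: rec1_if; rec_tac
  | |- rec1 (fun c => S _) => apply: (rec1_comp rec1_S); rec_tac
  | |- _ => try first [exact: rec1_const | by []]
  end.

Section CourseOfValues.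
Variable G : nat -> nat.

(** [history p n] codes the list of the values at n - 1, ..., 0. *)
Definition history (p n : nat) : nat :=
  nat_rect (fun=> nat) 0 (fun m h => cons_code (G (cons_code m (cons_code h p))) h) n.

Definition course (p n : nat) : nat := G (cons_code n (cons_code (history p n) p)).

Definition recall (h n m : nat) : nat :=
  head_code (nat_rect (fun=> nat) h (fun _ acc => tail_code acc) (n.-1 - m)).

Lemma recall_history p n m : m < n -> recall (history p n) n m = course p m.
Proof.
elim: n => // n IH; rewrite ltnS leq_eqVlt /recall /= => /orP[/eqP->|mn].
  by rewrite subnn /= head_cons.
rewrite -IH // /recall; have -> : n - m = (n.-1 - m).+1 by lia.
congr head_code; elim: (n.-1 - m) => [|k IHk]; first by rewrite /= tail_cons.
by rewrite /= in IHk *; rewrite IHk.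
Qed.

Hypothesis rG : rec1 G.

Lemma rec1_course p n : rec1 p -> rec1 n -> rec1 (fun c => course (p c) (n c)).
Proof.
move=> rp rn; apply: (rec1_comp rG); apply: (rec1_comp2 rec2_cons) => //.
apply: (rec1_comp2 rec2_cons) => //.
apply: (rec1_prim (g := fun=> 0)
  (h := fun m h c => cons_code (G (cons_code m (cons_code h (p c)))) h)) => //.
  exact: rec1_const.
apply: (rec1_comp2 rec2_cons); last by rec_tac.
apply: (rec1_comp rG); rec_tac.
by apply: (rec1_comp rp); rec_tac.
Qed.
End CourseOfValues.

Lemma rec1_recall h n m : rec1 h -> rec1 n -> rec1 m ->
  rec1 (fun c => recall (h c) (n c) (m c)).
Proof.
move=> rh rn rm; apply: (rec1_comp rec1_head).
apply: (rec1_prim (h := fun _ acc _ => tail_code acc)) => //; first by rec_tac.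
apply: (rec1_comp2 rec2_subn) => //; exact: (rec1_comp rec1_predn).
Qed.

(** * The evaluator on Goedel numbers *)

(** Environments are coded in base B, so that extending one by x at index 0
    is the map [e |-> x + B * e]. *)
Definition digit (B e i : nat) : nat := e %/ B ^ i %% B.

Definition term_step (D e tag x vx vy : nat) : nat :=
  if tag == 0 then digit D.+1 e x
  else if tag == 1 then
    if vx == D then D else if vy == D then D else (vx + vy) %% D
  else if tag == 2 then if vx == D then D else (D - vx) %% D
  else if tag == 3 then D
  else if tag == 4 then 0
  else D %/ (x + 2).

(** The context is the list of the term n, the history h, and the parameters
    e and D. *)
Definition term_rule (w : nat) : nat :=
  let n := head_code w in
  let h := head_code (tail_code w) in
  let e := head_code (tail_code (tail_code w)) in
  let D := tail_code (tail_code (tail_code w)) in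
  let x := head_code (tail_code n) in
  let y := head_code (tail_code (tail_code n)) in
  term_step D e (head_code n) x (recall h n x) (recall h n y).

Definition term_value_code (D e n : nat) : nat := course term_rule (cons_code e D) n.

Lemma term_value_codeE D e n :
  let val m := recall (history term_rule (cons_code e D) n) n m in
  let x := head_code (tail_code n) in
  let y := head_code (tail_code (tail_code n)) in
  term_value_code D e n = term_step D e (head_code n) x (val x) (val y).
Proof.
by rewrite /term_value_code /course /term_rule !(head_cons, tail_cons).
Qed.

Lemma term_value_codeP D e t :
  term_value_code D e (tcode t) = term_value D (digit D.+1 e) t.
Proof.
have sub n m : m < n ->
    recall (history term_rule (cons_code e D) n) n m = term_value_code D e m.
  exact: recall_history.
elim: t => [i|t IH u IH'|t IH|||k]; rewrite term_value_codeE.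
- by rewrite -[tcode _]/(cons_code 0 (cons_code i 0)) !(head_cons, tail_cons).
- have : tcode t + tcode u < tcode (Mul t u) by apply: (code_cons3_gt 1).
  rewrite -[tcode (Mul t u)]/(cons_code 1
    (cons_code (tcode t) (cons_code (tcode u) 0))) => lt.
  rewrite !(head_cons, tail_cons) !sub ?IH ?IH'; [|lia..].
  by rewrite /term_step /=; case: eqP.
- have : tcode t < tcode (Inv t) by apply: (code_cons2_gt 2).
  rewrite -[tcode (Inv t)]/(cons_code 2 (cons_code (tcode t) 0)) => lt.
  by rewrite !(head_cons, tail_cons) (sub _ _ lt) IH.
- by rewrite -[tcode _]/(cons_code 3 0) !(head_cons, tail_cons).
- by rewrite -[tcode _]/(cons_code 4 0) !(head_cons, tail_cons).
- rewrite -[tcode _]/(cons_code 5 (cons_code k 0)) !(head_cons, tail_cons).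
  by rewrite /term_step /= addn2.
Qed.

Definition formula_step (tag v0 v2 v3 : nat) : nat :=
  if tag == 0 then v0 else if tag == 1 then 0 else if tag == 2 then v2 else v3.

(** A quantifier changes the environment, so the environment cannot be
    a parameter of the recursion.  The pair of a formula n and an environment
    e < E has the index [m = n * E + e], which decreases with n whatever happens
    to e.  The context is the list of m, the history h, and b, D, E.  The
    universal quantifier counts its counterexamples. *)
Definition formula_rule (w : nat) : nat :=
  let m := head_code w in
  let h := head_code (tail_code w) in
  let b := head_code (tail_code (tail_code w)) in
  let D := head_code (tail_code (tail_code (tail_code w))) in
  let E := tail_code (tail_code (tail_code (tail_code w))) in
  let n := m %/ E in
  let e := m %% E in
  let x := head_code (tail_code n) in
  let y := head_code (tail_code (tail_code n)) in
  formula_step (head_code n)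
    (term_value_code D e x == term_value_code D e y)
    (if recall h m (x * E + e) == 0 then 1 else recall h m (y * E + e))
    (\sum_(i < D.+1)
       (if b ^ n %| i then
          nat_of_bool (recall h m (x * E + (i + D.+1 * e)) == 0)
        else 0) == 0).

Definition formula_value_code (b D E n e : nat) : nat :=
  course formula_rule (cons_code b (cons_code D E)) (n * E + e).

Lemma formula_value_codeE b D E n e : e < E ->
  let m := n * E + e in
  let h := history formula_rule (cons_code b (cons_code D E)) m in
  let val n' e' := recall h m (n' * E + e') in
  let x := head_code (tail_code n) in
  let y := head_code (tail_code (tail_code n)) in
  formula_value_code b D E n e = formula_step (head_code n)
    (term_value_code D e x == term_value_code D e y)
    (if val x e == 0 then 1 else val y e)
    (\sum_(i < D.+1)
       (if b ^ n %| i then nat_of_bool (val x (i + D.+1 * e) == 0) else 0) == 0).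
Proof.
move=> eE; rewrite /formula_value_code /course /formula_rule !(head_cons, tail_cons).
by rewrite modnMDl divnMDl ?(leq_ltn_trans _ eE) // (modn_small eE) (divn_small eE) addn0.
Qed.

Lemma digit_scons B e x : x < B -> digit B (x + B * e) = scons x (digit B e).
Proof.
move=> xB; apply: funext => -[|i]; rewrite /digit /=.
  by rewrite expn0 divn1 [B * e]mulnC addnC modnMDl modn_small.
rewrite expnS divnMA [B * e]mulnC addnC divnMDl ?(leq_ltn_trans _ xB) //.
by rewrite (divn_small xB) addn0.
Qed.

(** j bounds the number of quantifiers passed; together with the Goedel
    number it never exceeds C, which keeps environments below [D.+1 ^ C]. *)
Lemma formula_value_codeP b D C phi e j :
  fcode phi + j <= C -> e < D.+1 ^ j ->
  formula_value_code b D (D.+1 ^ C) (fcode phi) e = formula_value b D (digit D.+1 e) phi.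
Proof.
set E := D.+1 ^ C.
have sub m n' e' : n' * E + e' < m -> 
    recall (history formula_rule (cons_code b (cons_code D E)) m) m (n' * E + e') =
    formula_value_code b D E n' e'.
  exact: recall_history.
have expE i : i <= C -> D.+1 ^ i <= E by move=> iC; rewrite leq_pexp2l.
have index n n' e' e0 : n' < n -> e' < E -> n' * E + e' < n * E + e0.
  move=> nn e'E; have : n'.+1 * E <= n * E by rewrite leq_mul2r nn orbT.
  by rewrite mulSn; lia.
elim: phi e j => [t u||phi IH psi IH'|phi IH] e j phiC ej.
all: have eE : e < E by apply: leq_trans ej (expE _ _); lia.
all: rewrite formula_value_codeE //.
- rewrite -[fcode _]/(cons_code 0 (cons_code (tcode t) (cons_code (tcode u) 0))).
  by rewrite !(head_cons, tail_cons) !term_value_codeP.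
- by rewrite -[fcode _]/(cons_code 1 0) !(head_cons, tail_cons).
- have : fcode phi + fcode psi < fcode (Imp phi psi) by apply: (code_cons3_gt 2).
  move: phiC.
  rewrite -[fcode (Imp _ _)]/(cons_code 2
    (cons_code (fcode phi) (cons_code (fcode psi) 0))) => phiC lt.
  rewrite !(head_cons, tail_cons) !sub; try by apply: index; lia.
  rewrite (IH _ j) ?(IH' _ j) //; try lia.
  by rewrite /formula_step /=; case: (formula_value _ _ _ phi).
- have : fcode phi < fcode (All phi) by apply: (code_cons2_gt 3).
  rewrite formula_value_All; move: phiC.
  rewrite -[fcode (All phi)]/(cons_code 3 (cons_code (fcode phi) 0)).
  set c := cons_code 3 _ => phiC lt; rewrite {1 2}/c !(head_cons, tail_cons) /formula_step /=.
  congr nat_of_bool; rewrite sum_nat_eq0; apply: eq_forallb => i; rewrite implyTb.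
  case: ifP => // ci; rewrite implyTb.
  have iB : i < D.+1 := ltn_ord i.
  have ej' : i + D.+1 * e < D.+1 ^ j.+1.
    have : D.+1 * e.+1 <= D.+1 * D.+1 ^ j by rewrite leq_mul2l ej orbT.
    by rewrite expnS mulnS; lia.
  rewrite sub; last by apply: index => //; apply: leq_trans ej' (expE _ _); lia.
  rewrite (IH _ j.+1) //; last by lia.
  by rewrite digit_scons //; case: (formula_value _ _ _ _).
Qed.

Lemma rec1_digit B e i : rec1 B -> rec1 e -> rec1 i -> rec1 (fun c => digit (B c) (e c) (i c)).
Proof.
move=> rB re ri; rewrite /digit; apply: (rec1_comp2 rec2_modn) => //.
by apply: (rec1_comp2 rec2_divn) => //; apply: (rec1_comp2 rec2_expn).
Qed.

Lemma rec1_term_rule : rec1 term_rule.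
Proof.
rewrite /term_rule /term_step.
by rec_tac; try (apply: rec1_digit || apply: rec1_recall); rec_tac;
  apply: rec1_recall; rec_tac.
Qed.

Lemma rec1_term_value D e n : rec1 D -> rec1 e -> rec1 n ->
  rec1 (fun c => term_value_code (D c) (e c) (n c)).
Proof.
move=> rD re rn; apply: (rec1_course rec1_term_rule) => //.
exact: (rec1_comp2 rec2_cons).
Qed.

Lemma rec1_formula_rule : rec1 formula_rule.
Proof.
rewrite /formula_rule /formula_step.
rec_tac; try (apply: rec1_recall || apply: rec1_term_value); rec_tac.
pose body i x := if head_code (tail_code (tail_code x)) ^
    (head_code x %/ tail_code (tail_code (tail_code (tail_code x)))) %| i
  then nat_of_bool (recall (head_code (tail_code x)) (head_code x)
    (head_code (tail_code (head_code x %/ tail_code (tail_code (tail_code (tail_code x))))) *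
     tail_code (tail_code (tail_code (tail_code x))) +
     (i + (head_code (tail_code (tail_code (tail_code x)))).+1 *
      (head_code x %% tail_code (tail_code (tail_code (tail_code x)))))) == 0)
  else 0.
apply: (rec1_sum (f := body)); rewrite /body; rec_tac.
by apply: rec1_recall; rec_tac.
Qed.

Lemma rec1_level : rec1 level.
Proof.
apply: (rec1_ext (f := nat_rect (fun=> nat) 0 (fun _ k => (k + 2) ^ (k + 3)))) => //.
apply: (rec1_prim (g := fun=> 0) (n := id)
  (h := fun _ k _ => (k + 2) ^ (k + 3))); by rec_tac.
Qed.

Lemma rec1_fact : rec1 factorial.
Proof.
apply: (rec1_ext (f := fun c => nat_rect (fun=> nat) 1 (fun n acc => n.+1 * acc) c)).
  by elim=> //= n IH; rewrite IH factS.
by apply: (rec1_prim (h := fun n acc _ => n.+1 * acc)); rec_tac.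
Qed.

Theorem Cmul_decidable (R : realType) : decidable_theory (Cmul R).
Proof.
pose F c := formula_value_code (truth_base c) (truth_modulus c) ((truth_modulus c).+1 ^ c) c 0.
exists (fun v => F (nth 0 v 0)).
  rewrite -/(rec1 F).
  have rb : rec1 truth_base.
    by apply: (rec1_comp rec1_fact); do 2 apply: (rec1_comp rec1_S); apply: rec1_level.
  have rD : rec1 truth_modulus.
    rewrite /truth_modulus; apply: (rec1_comp2 rec2_expn) => //.
    by rec_tac.
  apply: (rec1_course rec1_formula_rule); rec_tac => //.
move=> phi phis; have digit0 B : digit B 0 = (fun=> 0).
  by apply: funext => i; rewrite /digit div0n mod0n.
rewrite /F /= (@formula_value_codeP _ _ _ _ _ 0) ?addn0 // digit0.
by congr nat_of_bool; apply/idP/asboolP; rewrite (models_formula_value R phis).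
Qed.

Theorem theorem2p2 (R : realType) :
  axiomatizes_mul_theory mul_axiom (Cmul R) /\
  quantifier_elimination (Cmul R) /\
  decidable_theory (Cmul R).
Proof.
split; first exact: mul_axiomatization.
by split; [exact: Cmul_quantifier_elimination | exact: Cmul_decidable].
Qed.
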